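(* Let $\zeta$ be an extremal number. Then \[ w_{3}(\zeta)=w_{2}(\zeta)=2+\sqrt{5}, \qquad \lambda_{3}(\zeta)=\frac{1}{\sqrt{5}}, \] and \[ \widehat{w}_{3}(\zeta)=3, \qquad \widehat{\lambda}_{3}(\zeta)=\frac{1}{3}. \]
   Context: For $P(T)=a_nT^n+\cdots+a_0\in\mathbb{Z}[T]$ let $H(P)=\max_j|a_j|$. For a real number $\zeta$ and an integer $n\ge1$: - $w_n(\zeta)$ (resp. $\widehat{w}_n(\zeta)$) is the supremum of $\eta\in\mathbb{R}$ such that the system $H(P)\le X$, $0<|P(\zeta)|\le X^{-\eta}$ has a solution $P\in\mathbb{Z}[T]$ of degree at most $n$ for arbitrarily large $X$ (resp. for all sufficiently large $X$). - $\lambda_n(\zeta)$ (resp. $\widehat{\lambda}_n(\zeta)$) is the supremum of $\eta\in\mathbb{R}$ such that the system $0<|x|\le X$, $\max_{1\le i\le n}|\zeta^i x-y_i|\le X^{-\eta}$ has a solution $(x,y_1,\dots,y_n)\in\mathbb{Z}^{n+1}$ for arbitrarily large $X$ (resp. for all sufficiently large $X$). For every transcendental real $\zeta$ one has $\widehat{w}_2(\zeta)\le (3+\sqrt5)/2$ (Davenport–Schmidt). A real transcendental number $\zeta$ is called an extremal number (Roy) if $\widehat{w}_2(\zeta)=(3+\sqrt5)/2$. *)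

(* Defs.v *)
From HB Require Import structures.
From mathcomp Require Import all_boot all_order all_algebra.
From mathcomp Require Import all_classical all_reals all_analysis.
Set Implicit Arguments.
Unset Strict Implicit.
Unset Printing Implicit Defensive.
Import Order.TTheory GRing.Theory Num.Theory.
Import numFieldNormedType.Exports.
Local Open Scope classical_set_scope.
Local Open Scope ring_scope.

Definition height (P : {poly int}) : nat := (\max_(j < size P) absz (P`_j)%R)%N.

Section Exponents.
Context {R : realType}.
Implicit Types (n : nat) (zeta eta X : R).

Definition poly_system n zeta eta X : Prop :=
  exists P : {poly int},
    [/\ (size P <= n.+1)%N, (height P)%:R <= X
      & 0 < `|(map_poly intr P).[zeta]| <= X `^ (- eta)].

(* y i stands for y_{i+1}, hence the exponent i.+1. *)
Definition simul_system n zeta eta X : Prop :=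
  exists (x : int) (y : 'I_n -> int),
    0 < `|x%:~R : R| <= X /\
    \big[Num.max/0]_(i < n) `|zeta ^+ i.+1 * x%:~R - (y i)%:~R| <= X `^ (- eta).

Definition arbitrarily_large (Q : R -> Prop) : Prop :=
  forall B : R, exists2 X, B < X & Q X.

Definition sufficiently_large (Q : R -> Prop) : Prop :=
  exists B : R, forall X, B < X -> Q X.

(* The exponents may be +oo (e.g. at Liouville numbers), so the suprema are
   taken in the extended reals. *)
Definition w n zeta : \bar R :=
  ereal_sup [set eta%:E | eta in
    [set eta | arbitrarily_large (poly_system n zeta eta)]].

Definition w_hat n zeta : \bar R :=
  ereal_sup [set eta%:E | eta in
    [set eta | sufficiently_large (poly_system n zeta eta)]].

Definition lambda n zeta : \bar R :=
  ereal_sup [set eta%:E | eta in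
    [set eta | arbitrarily_large (simul_system n zeta eta)]].

Definition lambda_hat n zeta : \bar R :=
  ereal_sup [set eta%:E | eta in
    [set eta | sufficiently_large (simul_system n zeta eta)]].

Definition transcendental zeta : Prop :=
  ~ algebraicOver (ratr : rat -> R) zeta.

Definition extremal zeta : Prop :=
  transcendental zeta /\ w_hat 2 zeta = ((3 + Num.sqrt 5) / 2)%:E.

End Exponents.

(* Main.v *)
(* Write g for the golden ratio.  Along a sequence of small values P_i(zeta) of
   integer quadratics, w_hat_2 = g^2 forces the Davenport-Schmidt inequalities to
   be equalities up to epsilon: the P_i that are linearly independent of their two
   neighbours form a sequence Q_k with H(Q_{k+1}) = H(Q_k)^(g + o(1)),
   |Q_k(zeta)| = H(Q_k)^(-g^3 + o(1)) and Res(Q_k, Q_{k+1}) = H(Q_k)^(o(1)),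
   nonzero.  So Q_k, T Q_k, Q_{k+1}, T Q_{k+1} are almost a basis of the lattice of
   integer cubics, which controls w_3, and the cofactors of Q_k, T Q_k, Q_{k+1}
   give lambda_3 >= 1/sqrt 5.

   The cross product x of the coefficient vectors of Q_k and Q_{k+1}, read as the
   symmetric matrix (x0, x1; x1, x2), is close to a multiple of
   (1, zeta; zeta, zeta^2) and has determinant Res(Q_k, Q_{k+1}) up to sign.  Its
   rows are two independent linear forms of height Y and value 1/Y at zeta, with
   Y = H(Q_{k+2}) up to epsilon.  This bounds rational approximation to zeta, and
   the products of these forms with Q_{k+3}, together with Q_{k+4} and T Q_{k+4},
   are four independent cubics of height X and value X^(-3), which gives the upper
   bounds for w_hat_3 and lambda_hat_3.  For lambda_3 <= 1/sqrt 5, a good point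
   orthogonal to Q_k and T Q_k is paired with Q_{k-1} and T Q_{k-1}; the symmetric
   matrix turns the resulting pair into a rational approximation to zeta that is
   too good to exist. *)
Require Import Defs.
From HB Require Import structures.
From mathcomp Require Import all_boot all_order all_algebra.
From mathcomp Require Import all_classical all_reals all_analysis.
From mathcomp Require Import ring lra zify.
Set Implicit Arguments.
Unset Strict Implicit.
Unset Printing Implicit Defensive.
Import Order.TTheory GRing.Theory Num.Theory.
Local Open Scope ring_scope.

(** * Ternary vectors and resultants *)

(** The upper bounds for the exponents rest on a nonzero integer having absolute value at least 1,
    the integer being a determinant, a resultant or the pairing of two integer vectors. The obstacle
    is nonvanishing: neighbours among the minimal quadratics may share a linear factor, so their
    coprimality has to be proved ([ms_coprime]), and it holds only from some index on. All sizes are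
    written as exponentials. Each estimate draws its own sequence, with its own eps and a starting
    height T so large that the constant factors are absorbed by exp(eps t). What remains are linear
    inequalities between exponents, collected in [roy_arith], [four_arith], [w3_arith] and
    [lambda3_arith]. *)

Section Cross.
Context {R : realType}.
Implicit Types (z X Y A B : R) (a b c N M : nat -> R).

Definition int_vec a : Prop := forall i, a i \is a Num.int.

Definition bounded_by X a : Prop := forall i, `|a i| <= X.

Definition eval2 z a : R := a 0%N + a 1%N * z + a 2%N * z ^+ 2.

(** The last case also covers the indices above 2, so that [int_vec] and [bounded_by], which
    quantify over all indices, pass to cross products. *)
Definition cross a b : nat -> R := fun i =>
  match i with
  | 0%N => a 1%N * b 2%N - a 2%N * b 1%N
  | 1%N => a 2%N * b 0%N - a 0%N * b 2%N
  | _ => a 0%N * b 1%N - a 1%N * b 0%N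
  end.

(* [disc (cross a b)] is the resultant of the two quadratics, up to sign. *)
Definition disc N : R := N 0%N * N 2%N - N 1%N ^+ 2.

Definition det3 a b c : R :=
  cross a b 0 * c 0%N + cross a b 1 * c 1%N + cross a b 2 * c 2%N.

Lemma int_norm_lt1 (x : R) : x \is a Num.int -> `|x| < 1 -> x = 0.
Proof.
move=> xi x1; apply/eqP; apply: contraTT x1 => x0.
by rewrite -leNgt norm_intr_ge1.
Qed.

Lemma int_vec_cross a b : int_vec a -> int_vec b -> int_vec (cross a b).
Proof. by move=> ha hb [|[|i]] /=; rewrite rpredB // rpredM. Qed.

Lemma int_disc N : int_vec N -> disc N \is a Num.int.
Proof. by move=> hN; rewrite rpredB ?rpredX // rpredM. Qed.

Lemma int_det3 a b c : int_vec a -> int_vec b -> int_vec c ->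
  det3 a b c \is a Num.int.
Proof.
move=> ha hb hc; have hN := int_vec_cross ha hb.
by rewrite /det3 !rpredD // rpredM.
Qed.

Lemma ler_normM (x y X Y : R) : `|x| <= X -> `|y| <= Y -> `|x * y| <= X * Y.
Proof. by move=> hx hy; rewrite normrM ler_pM. Qed.

Lemma ler_normDD (x y X Y : R) : `|x| <= X -> `|y| <= Y -> `|x + y| <= X + Y.
Proof. by move=> hx hy; apply: (le_trans (ler_normD _ _)); apply: lerD. Qed.

Lemma ler_normBB (x y X Y : R) : `|x| <= X -> `|y| <= Y -> `|x - y| <= X + Y.
Proof. by move=> hx hy; apply: ler_normDD; rewrite ?normrN. Qed.

Lemma bounded_ge0 X a : bounded_by X a -> 0 <= X.
Proof. by move=> /(_ 0%N); apply: le_trans. Qed.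

Lemma bounded_cross X Y a b : bounded_by X a -> bounded_by Y b ->
  bounded_by (2 * (X * Y)) (cross a b).
Proof.
move=> ha hb i; have -> : 2 * (X * Y) = X * Y + X * Y by ring.
by case: i => [|[|i]] /=; apply: ler_normBB; apply: ler_normM.
Qed.

Lemma cross_drift1 z a b :
  cross a b 1 - z * cross a b 0 = a 2%N * eval2 z b - b 2%N * eval2 z a.
Proof. by rewrite /cross /eval2; ring. Qed.

Lemma cross_drift2 z a b :
  cross a b 2 - z * cross a b 1 =
  (b 1%N * eval2 z a - a 1%N * eval2 z b)
  + z * (b 2%N * eval2 z a - a 2%N * eval2 z b).
Proof. by rewrite /cross /eval2; ring. Qed.

(** Measures how far N is from the line spanned by (1, z, z^2). *)
Definition drift z N : R :=
  Num.max `|N 1%N - z * N 0%N| `|N 2%N - z * N 1%N|.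

Lemma drift1 z N : `|N 1%N - z * N 0%N| <= drift z N.
Proof. by rewrite /drift le_max lexx. Qed.

Lemma drift2 z N : `|N 2%N - z * N 1%N| <= drift z N.
Proof. by rewrite /drift le_max lexx orbT. Qed.

Lemma drift_cross z X Y A B a b : bounded_by X a -> bounded_by Y b ->
  `|eval2 z a| <= A -> `|eval2 z b| <= B ->
  drift z (cross a b) <= (1 + `|z|) * (X * B + Y * A).
Proof.
move=> ha hb hA hB.
have h1 i : `|a i * eval2 z b - b i * eval2 z a| <= X * B + Y * A.
  by apply: ler_normBB; apply: ler_normM.
have h2 i : `|b i * eval2 z a - a i * eval2 z b| <= X * B + Y * A.
  by rewrite distrC.
rewrite /drift ge_max cross_drift1 cross_drift2; apply/andP; split.
  apply: le_trans (h1 2%N) _; rewrite ler_peMl ?lerDl //.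
  exact: le_trans (h1 2%N).
rewrite mulrDl mul1r; apply: ler_normDD => //.
by apply: ler_normM.
Qed.

(** [disc] vanishes on the multiples of (1, z, z^2), hence is at most size times drift. *)
Lemma norm_disc z X N : bounded_by X N -> `|disc N| <= 2 * (X * drift z N).
Proof.
move=> hN.
have -> : disc N = N 0%N * (N 2%N - z * N 1%N) - N 1%N * (N 1%N - z * N 0%N).
  by rewrite /disc; ring.
have -> : 2 * (X * drift z N) = X * drift z N + X * drift z N by ring.
by apply: ler_normBB; apply: ler_normM => //; rewrite ?drift1 ?drift2.
Qed.

(** Adding multiples of the other columns to the first turns its entries into the values at z; each
    remaining 2x2 minor has two terms, whence the factor 2. *)
Lemma norm_det3 z X Y Z A B C a b c :
  bounded_by X a -> bounded_by Y b -> bounded_by Z c ->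
  `|eval2 z a| <= A -> `|eval2 z b| <= B -> `|eval2 z c| <= C ->
  `|det3 a b c| <= 2 * (A * Y * Z + B * X * Z + C * X * Y).
Proof.
move=> ha hb hc hA hB hC.
have -> : det3 a b c =
  eval2 z a * cross b c 0 + eval2 z b * cross c a 0 + eval2 z c * cross a b 0.
  by rewrite /det3 /cross /eval2; ring.
have -> : 2 * (A * Y * Z + B * X * Z + C * X * Y) =
  A * (2 * (Y * Z)) + B * (2 * (Z * X)) + C * (2 * (X * Y)) by ring.
by do 2?apply: ler_normDD; apply: ler_normM => //; apply: bounded_cross.
Qed.

Definition nonzero3 N : Prop := ~ [/\ N 0%N = 0, N 1%N = 0 & N 2%N = 0].

Definition parallel N M : Prop := exists2 r : R, r != 0 &
  [/\ M 0%N = r * N 0%N, M 1%N = r * N 1%N & M 2%N = r * N 2%N].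

Lemma parallel_refl N : parallel N N.
Proof. by exists 1; rewrite ?oner_neq0 ?mul1r. Qed.

Lemma parallel_trans N M L : parallel N M -> parallel M L -> parallel N L.
Proof.
move=> [r r0 [h0 h1 h2]] [s s0 [k0 k1 k2]].
by exists (s * r); rewrite ?mulf_neq0 // k0 k1 k2 h0 h1 h2 !mulrA.
Qed.

Lemma parallel_of_minors N M : nonzero3 N -> nonzero3 M ->
  N 0%N * M 1%N = N 1%N * M 0%N -> N 0%N * M 2%N = N 2%N * M 0%N ->
  N 1%N * M 2%N = N 2%N * M 1%N -> parallel N M.
Proof.
move=> hN hM h01 h02 h12.
have [N0|N0] := eqVneq (N 0%N) 0; last first.
  exists (M 0%N / N 0%N).
    rewrite mulf_neq0 ?invr_eq0 //; apply/eqP => M0; apply: hM; split=> //.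
      by apply: (mulfI N0); rewrite h01 M0 !mulr0.
    by apply: (mulfI N0); rewrite h02 M0 !mulr0.
  split; first by rewrite divfK.
    by apply: (mulfI N0); rewrite h01; field.
  by apply: (mulfI N0); rewrite h02; field.
have [N1|N1] := eqVneq (N 1%N) 0; last first.
  exists (M 1%N / N 1%N).
    rewrite mulf_neq0 ?invr_eq0 //; apply/eqP => M1; apply: hM; split=> //.
      by apply: (mulfI N1); rewrite -h01 M1 !mulr0.
    by apply: (mulfI N1); rewrite h12 M1 !mulr0.
  split; last 2 first.
  - by rewrite divfK.
  - by apply: (mulfI N1); rewrite h12; field.
  by apply: (mulfI N1); rewrite -h01 N0; ring.
have N2 : N 2%N != 0 by apply/eqP => N2; apply: hN.
have M0 : M 0%N = 0 by apply: (mulfI N2); rewrite -h02 N0; ring.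
have M1 : M 1%N = 0 by apply: (mulfI N2); rewrite -h12 N1; ring.
exists (M 2%N / N 2%N).
  by rewrite mulf_neq0 ?invr_eq0 //; apply/eqP => M2; apply: hM.
by rewrite N0 N1 M0 M1 !mulr0 divfK.
Qed.

(** The minors are the coordinates of (a x b) x (b x c) = det(a, b, c) b. *)
Lemma parallel_cross a b c : nonzero3 (cross a b) -> nonzero3 (cross b c) ->
  det3 a b c = 0 -> parallel (cross a b) (cross b c).
Proof.
move=> hN hM d0; apply: parallel_of_minors => //; apply/eqP; rewrite -subr_eq0.
- have -> : cross a b 0 * cross b c 1 - cross a b 1 * cross b c 0 =
     b 2%N * det3 a b c by rewrite /det3 /cross; ring.
  by rewrite d0 mulr0.
- have -> : cross a b 0 * cross b c 2 - cross a b 2 * cross b c 0 =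
     - b 1%N * det3 a b c by rewrite /det3 /cross; ring.
  by rewrite d0 mulr0.
have -> : cross a b 1 * cross b c 2 - cross a b 2 * cross b c 1 =
   b 0%N * det3 a b c by rewrite /det3 /cross; ring.
by rewrite d0 mulr0.
Qed.

Lemma disc_parallel N M : parallel N M -> disc N != 0 -> disc M != 0.
Proof.
move=> [r r0 [h0 h1 h2]] dN; rewrite /disc h0 h1 h2.
have -> : r * N 0%N * (r * N 2%N) - (r * N 1%N) ^+ 2 = r ^+ 2 * disc N.
  by rewrite /disc; ring.
by rewrite mulf_neq0 // expf_neq0.
Qed.

(* The polar form of [disc] at [(N, M)] is a nonzero integer, although only the
   size of [N] and the drift of [M] enter the bound. *)
Lemma parallel_drift z X N M : int_vec N -> int_vec M -> bounded_by X N ->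
  parallel N M -> disc N != 0 -> 1 <= 4 * (X * drift z M).
Proof.
move=> iN iM bN [r r0 [h0 h1 h2]] dN.
pose P := N 0%N * M 2%N + N 2%N * M 0%N - 2 * (N 1%N * M 1%N).
have PE : P = 2 * r * disc N by rewrite /P /disc h0 h1 h2; ring.
have P0 : P != 0 by rewrite PE !mulf_neq0 // pnatr_eq0.
have Pi : P \is a Num.int.
  by rewrite /P rpredB ?rpredD ?rpredM ?rpred_nat.
apply: le_trans (norm_intr_ge1 Pi P0) _.
have dM : drift z M = `|r| * drift z N.
  rewrite /drift h0 h1 h2.
  have -> : r * N 1%N - z * (r * N 0%N) = r * (N 1%N - z * N 0%N) by ring.
  have -> : r * N 2%N - z * (r * N 1%N) = r * (N 2%N - z * N 1%N) by ring.
  by rewrite !normrM maxr_pMr.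
rewrite PE dM !normrM (ger0_norm (ler0n _ 2)).
have h := norm_disc z bN.
have h' := ler_wpM2l (normr_ge0 r) h.
nra.
Qed.

(** Expansion of v^2 a(u/v) around z, free of division and so valid for v = 0. *)
Lemma eval_lincomb z a (u v : R) :
  a 0%N * v ^+ 2 + a 1%N * (u * v) + a 2%N * u ^+ 2 =
  v ^+ 2 * eval2 z a + (u - v * z) * (a 1%N * v + a 2%N * (u + v * z)).
Proof. by rewrite /eval2; ring. Qed.

End Cross.

(** * Consecutive minimal quadratics are coprime *)

(** Rational root theorem: v divides the leading coefficient c, or b when c = 0. *)
Lemma divisor_root_le (u v a b c : int) : coprimez u v ->
  a * v ^+ 2 + b * (u * v) + c * u ^+ 2 = 0 ->
  ~ [/\ a = 0, b = 0 & c = 0] ->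
  `|v| <= Num.max `|a| (Num.max `|b| `|c|).
Proof.
move=> cuv e nz.
have dvd_le (x y : int) : y != 0 -> (x %| y)%Z -> `|x| <= `|y|.
  move=> y0 /dvdzP[q qE]; rewrite qE normrM ler_peMl //.
  have : q != 0 by apply: contraNneq y0 => q0; rewrite qE q0 mul0r.
  by rewrite -normr_gt0; lia.
have cvu : coprimez v u by rewrite coprimez_sym.
have [c0|c0] := eqVneq c 0; last first.
  rewrite !le_max; apply/orP; right; apply/orP; right; apply: dvd_le => //.
  rewrite -(@Gauss_dvdzr v (u ^+ 2)) ?coprimezXr //.
  by apply/dvdzP; exists (- (a * v + b * u)); lia.
have [v0|v0] := eqVneq v 0; first by rewrite v0 normr0 le_max normr_ge0.
have e' : a * v + b * u = 0 by apply: (mulfI v0); rewrite mulr0; lia.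
have [b0|b0] := eqVneq b 0.
  case: nz; split=> //; apply: (mulIf v0); lia.
rewrite !le_max; apply/orP; right; apply/orP; left; apply: dvd_le => //.
rewrite -(@Gauss_dvdzr v u) //.
by apply/dvdzP; exists (- a); lia.
Qed.

(** Put u/v = n1/n0 in lowest terms and g = gcd(n0, n1). The equation becomes v n2 = g u^2, so v
    divides g and c = g/v. *)
Lemma conic_param (n0 n1 n2 : int) : ~ [/\ n0 = 0, n1 = 0 & n2 = 0] ->
  n0 * n2 = n1 ^+ 2 ->
  exists u v c : int, [/\ coprimez u v, c != 0,
    n0 = c * v ^+ 2, n1 = c * (u * v) & n2 = c * u ^+ 2].
Proof.
move=> nz e.
have [n00|n00] := eqVneq n0 0.
  have n10 : n1 = 0 by apply/eqP; rewrite -sqrf_eq0 -e n00 mul0r.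
  exists 1, 0, n2; split.
  - by rewrite /coprimez gcdz0.
  - by apply/eqP => n20; apply: nz.
  - by rewrite n00 expr0n mulr0.
  - by rewrite n10 !mulr0.
  by rewrite expr1n mulr1.
have [[p q] /= bez] : exists pq : int * int, pq.1 * n0 + pq.2 * n1 = gcdz n0 n1.
  by have [p [q h]] := Bezoutz n0 n1; exists (p, q).
set g := gcdz n0 n1 in bez.
have g0 : g != 0 by rewrite gcdz_eq0 negb_and n00.
have /dvdzP[v vE] : (g %| n0)%Z := dvdz_gcdl n0 n1.
have /dvdzP[u uE] : (g %| n1)%Z := dvdz_gcdr n0 n1.
clearbody g.
have cuv : coprimez u v.
  by apply/coprimezP; exists (q, p) => /=; apply: (mulIf g0);
    rewrite mul1r -[RHS]bez vE uE; ring.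
have v0 : v != 0 by apply: contraNneq n00 => v0; rewrite vE v0 mul0r.
have e' : v * n2 = g * u ^+ 2.
  apply: (mulfI g0); transitivity (n0 * n2); first by rewrite vE; ring.
  by rewrite e uE; ring.
have /dvdzP[c cE] : (v %| g)%Z.
  rewrite -(@Gauss_dvdzl v g (u ^+ 2)) ?coprimezXr 1?coprimez_sym //.
  by apply/dvdzP; exists n2; lia.
exists u, v, c; split=> //.
- by apply: contraNneq g0 => c0; rewrite cE c0 mul0r.
- by rewrite vE cE; ring.
- by rewrite uE cE; ring.
by apply: (mulfI v0); rewrite e' cE; ring.
Qed.

Lemma descending_ind (P : nat -> Prop) (n : nat) : P n.+1 ->
  (forall j, (j <= n)%N -> P j.+1 -> P j) -> P 0%N.
Proof.
elim: n => [|n IH] Pn step; first exact: step Pn.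
apply: IH => [|j jn]; first exact: step Pn.
by apply: step; apply: leqW.
Qed.

Section MinSeq.
Context {R : realType}.
Implicit Types (z w X Y A B : R) (N : nat -> R).

(** When N is the cross product of two quadratics, u/v is their common root. The last clause is
    Gauss's lemma in disguise: v T - u divides every integer quadratic vanishing at u/v, so its
    height is at most that of the quadratic. *)
Lemma disc0_param N : int_vec N -> nonzero3 N -> disc N = 0 ->
  exists u v c : R,
  [/\ u \is a Num.int /\ v \is a Num.int, ~ (u = 0 /\ v = 0), 1 <= `|c|,
   [/\ N 0%N = c * v ^+ 2, N 1%N = c * (u * v) & N 2%N = c * u ^+ 2]
  & forall X a, int_vec a -> nonzero3 a -> bounded_by X a ->
    a 0%N * v ^+ 2 + a 1%N * (u * v) + a 2%N * u ^+ 2 = 0 ->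
    `|u| <= X /\ `|v| <= X].
Proof.
move=> iN nzN d0.
have [[n0 h0] [n1 h1] [n2 h2]] :
  [/\ exists m : int, N 0%N = m%:~R, exists m : int, N 1%N = m%:~R
    & exists m : int, N 2%N = m%:~R] by split; apply/intrP.
have e : n0 * n2 = n1 ^+ 2.
  apply/eqP; rewrite -subr_eq0 -(intr_eq0 R) rmorphB rmorphXn rmorphM /=.
  by rewrite -h0 -h1 -h2 -/(disc N) d0.
have [|u [v [c [cuv c0 e0 e1 e2]]]] := conic_param _ e.
  by move=> [k0 k1 k2]; apply: nzN; rewrite h0 h1 h2 k0 k1 k2.
exists u%:~R, v%:~R, c%:~R; split.
- by rewrite !intr_int.
- case=> /eqP; rewrite intr_eq0 => /eqP u0 /eqP; rewrite intr_eq0 => /eqP v0.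
  by move: cuv; rewrite u0 v0 /coprimez gcdz0.
- by rewrite norm_intr_ge1 ?intr_int ?intr_eq0.
- by rewrite h0 h1 h2 e0 e1 e2 !rmorphM.
move=> X a ia nza ba.
have [[a0 k0] [a1 k1] [a2 k2]] :
  [/\ exists m : int, a 0%N = m%:~R, exists m : int, a 1%N = m%:~R
    & exists m : int, a 2%N = m%:~R] by split; apply/intrP.
rewrite k0 k1 k2 -!rmorphXn -!rmorphM -!rmorphD /= => /eqP; rewrite intr_eq0.
move=> /eqP ea.
have nz : ~ [/\ a0 = 0, a1 = 0 & a2 = 0].
  by move=> [l0 l1 l2]; apply: nza; rewrite k0 k1 k2 l0 l1 l2.
have bX (m : int) : m <= Num.max `|a0| (Num.max `|a1| `|a2|) -> m%:~R <= X.
  rewrite !le_max => /or3P[] h.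
  - by apply: le_trans (ba 0%N); rewrite k0 -intr_norm ler_int.
  - by apply: le_trans (ba 1%N); rewrite k1 -intr_norm ler_int.
  by apply: le_trans (ba 2%N); rewrite k2 -intr_norm ler_int.
split; rewrite -intr_norm; apply: bX; last exact: divisor_root_le cuv ea nz.
(* The reversed quadratic has the inverse root, which bounds u. *)
have h := @divisor_root_le v u a2 a1 a0.
rewrite maxA maxC (maxC `|a0|); apply: h; first by rewrite coprimez_sym.
  by rewrite -ea; ring.
by move=> [l0 l1 l2]; apply: nz.
Qed.

Definition transcendental2 z : Prop :=
  forall a, int_vec a -> nonzero3 a -> eval2 z a != 0.

Lemma bounded_eval_lower z (K : nat) : transcendental2 z ->
  exists2 c : R, 0 < c &
    forall a, int_vec a -> nonzero3 a -> bounded_by K%:R a -> c <= `|eval2 z a|.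
Proof.
move=> htr.
(* Only finitely many quadratics are concerned: coefficients in [-K, K] are encoded as ordinals
   shifted by K. *)
pose v (t : 'I_(2 * K).+1 * 'I_(2 * K).+1 * 'I_(2 * K).+1) (i : nat) : R :=
  match i with
  | 0%N => (t.1.1 : nat)%:R - K%:R
  | 1%N => (t.1.2 : nat)%:R - K%:R
  | _ => (t.2 : nat)%:R - K%:R
  end.
pose c := \big[Num.min/1]_(t | eval2 z (v t) != 0) `|eval2 z (v t)|.
exists c.
  by apply: lt_bigmin => // t; rewrite normr_gt0.
move=> a ia nza ba.
have rep i : exists k : 'I_(2 * K).+1, a i = (k : nat)%:R - K%:R.
  have /intrP[m mE] := ia i.
  have hm : `|m| <= K%:Z by rewrite -(ler_int R) intr_norm -mE; exact: ba.
  pose k : nat := absz (m + K%:Z).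
  have hk : (k < (2 * K).+1)%N by rewrite /k; lia.
  exists (Ordinal hk) => /=; rewrite mE.
  have -> : k%:R = (m + K%:Z)%:~R :> R.
    rewrite -[LHS]/(k%:Z%:~R) /k gez0_abs //; lia.
  by rewrite rmorphD /= addrK.
have [[k0 h0] [k1 h1] [k2 h2]] := And3 (rep 0%N) (rep 1%N) (rep 2%N).
have -> : eval2 z a = eval2 z (v (k0, k1, k2)).
  by rewrite /eval2 h0 h1 h2.
apply: bigmin_le_cond; have := htr a ia nza.
by rewrite /eval2 h0 h1 h2.
Qed.

Record min_seq z w (a : nat -> nat -> R) (x : nat -> R) : Prop := MinSeq {
  ms_int : forall i, int_vec (a i);
  ms_bounded : forall i, bounded_by (expR (x i)) (a i);
  ms_ge0 : forall i, 0 <= x i;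
  ms_mono : forall i, x i <= x i.+1;
  ms_pos : forall i, 0 < `|eval2 z (a i)|;
  ms_half : forall i, `|eval2 z (a i.+1)| <= `|eval2 z (a i)| / 2;
  ms_exponent : forall i, `|eval2 z (a i)| <= 2 * expR (- w * x i.+1);
  ms_indep_lt : forall i j, (i < j)%N -> nonzero3 (cross (a i) (a j));
  ms_unbounded : forall T, exists i, T <= x i }.

Arguments ms_int {z w a x} ms i : rename.
Arguments ms_bounded {z w a x} ms i : rename.

Lemma ms_indep z w a x : min_seq z w a x ->
  forall i, nonzero3 (cross (a i) (a i.+1)).
Proof. by move=> ms i; apply: (ms_indep_lt ms). Qed.

Arguments ms_indep {z w a x} ms i _ : rename.

Lemma ms_nz z w a x : min_seq z w a x -> forall i, nonzero3 (a i).
Proof.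
move=> ms i [a0 a1 a2]; case: (ms_indep ms i).
by rewrite /cross a0 a1 a2; split; ring.
Qed.

Arguments ms_nz {z w a x} ms i _ : rename.

Lemma ms_le z w a x : min_seq z w a x -> forall i j, (i <= j)%N -> x i <= x j.
Proof.
move=> ms i j ij; rewrite -(subnK ij); elim: (j - i)%N => //= k IH.
by rewrite addSn; apply: le_trans IH (ms_mono ms _).
Qed.

Lemma ms_drift z w a x : min_seq z w a x -> forall i,
  drift z (cross (a i) (a i.+1)) <=
  2 * (1 + `|z|) * (expR (x i.+1) * `|eval2 z (a i)|).
Proof.
move=> ms i.
have h := drift_cross (ms_bounded ms i) (ms_bounded ms i.+1)
  (lexx `|eval2 z (a i)|) (lexx `|eval2 z (a i.+1)|).
apply: le_trans h _.
have -> : 2 * (1 + `|z|) * (expR (x i.+1) * `|eval2 z (a i)|) =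
  (1 + `|z|) * (expR (x i.+1) * `|eval2 z (a i)| + expR (x i.+1) * `|eval2 z (a i)|).
  by ring.
apply: ler_wpM2l; first by rewrite addr_ge0.
rewrite lerD // ler_pM ?expR_ge0 ?ler_expR ?(ms_mono ms) //.
have := ms_half ms i; have := ms_pos ms i; lra.
Qed.

(* If two consecutive members share the linear factor [v T - u], that factor is
   such a good approximation that it divides all earlier members as well. *)
Lemma ms_coprime z w a x : 2 < w -> transcendental2 z -> min_seq z w a x ->
  exists i0, forall i, (i0 <= i)%N -> disc (cross (a i) (a i.+1)) != 0.
Proof.
move=> w2 htr ms.
pose Z : R := 1 + `|z|; have Z1 : 1 <= Z by rewrite lerDl.
(* C adds the coefficients of the two error terms in [step] below, and C exp((2 - w) eta) < 1 once
   eta > T. *)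
pose C : R := 2 + 8 * Z ^+ 2; pose T : R := C / (w - 2).
have T0 : 0 <= T by rewrite divr_ge0 //; rewrite /C; nra.
(* Two ways to bound the height h of the common factor: either h <= exp T, or the descent carries
   the factor down to [a 0], whose height then bounds h. *)
pose K' := Num.max T (x 0%N).
pose n := (Num.trunc (expR K')).+1.
have nK : expR K' <= n%:R by apply/ltW/truncnS_gt; rewrite ?expR_ge0.
have [c c0 hc] := bounded_eval_lower n htr.
have [i0 hi0] := ms_unbounded ms (4 * Z / c / (w - 1)).
exists i0 => i ii0; apply/eqP => d0.
have iN := int_vec_cross (ms_int ms i) (ms_int ms i.+1).
have [u [v [k [[ui vi] uv0 k1 [N0 N1 N2] hroot]]]] :=
  disc0_param iN (ms_indep ms i) d0.
pose h : R := Num.max `|u| `|v|; pose l : R := `|u - v * z|.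
have hu : `|u| <= h by rewrite le_max lexx.
have hv : `|v| <= h by rewrite le_max lexx orbT.
have h1 : 1 <= h.
  have [u0|u0] := eqVneq u 0.
    have v0 : v != 0 by apply/eqP => v0; apply: uv0.
    exact: le_trans (norm_intr_ge1 vi v0) hv.
  exact: le_trans (norm_intr_ge1 ui u0) hu.
have h0 : 0 < h by lra.
have l0 : 0 <= l by rewrite normr_ge0.
have lh : l * h <= 4 * Z * expR ((1 - w) * x i.+1).
  have hd : l * h <= drift z (cross (a i) (a i.+1)).
    rewrite /drift N0 N1 N2.
    have -> : k * (u * v) - z * (k * v ^+ 2) = k * (v * (u - v * z)) by ring.
    have -> : k * u ^+ 2 - z * (k * (u * v)) = k * (u * (u - v * z)) by ring.
    have st t : l * `|t| <= `|k * (t * (u - v * z))|.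
      by rewrite !normrM mulrC ler_peMl // mulr_ge0.
    by rewrite {1}/h; case: (leP `|u| `|v|) => _; rewrite le_max st ?orbT.
  apply: le_trans hd _; apply: le_trans (ms_drift ms i) _.
  have -> : (1 - w) * x i.+1 = x i.+1 + (- w * x i.+1) by ring.
  rewrite expRD; have := ms_exponent ms i; have := expR_gt0 (x i.+1).
  rewrite -/Z; set e := expR _; set e' := expR _; set p := `|_| => e0 pe.
  have := ler_wpM2l (ltW e0) pe; nra.
pose F j := a j 0%N * v ^+ 2 + a j 1%N * (u * v) + a j 2%N * u ^+ 2.
have Fh j : F j = 0 -> h <= expR (x j).
  move=> Fj; have [hu' hv'] := hroot _ _ (ms_int ms j) (ms_nz ms j)
    (ms_bounded ms j) Fj.
  by rewrite /h ge_max hu' hv'.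
have Fi : F i.+1 = 0.
  have k0 : k != 0 by rewrite -normr_gt0; lra.
  apply: (mulfI k0); rewrite mulr0.
  have -> : k * F i.+1 = a i.+1 0%N * cross (a i) (a i.+1) 0
     + a i.+1 1%N * cross (a i) (a i.+1) 1 + a i.+1 2%N * cross (a i) (a i.+1) 2.
    by rewrite N0 N1 N2 /F; ring.
  by rewrite /cross; ring.
have hle : h <= expR K'.
  rewrite leNgt; apply/negP => hK.
  have hT : expR T < h by apply: le_lt_trans hK; rewrite ler_expR le_max lexx.
  pose eta := ln h.
  have hE : h = expR eta by rewrite /eta lnK.
  have Teta : T < eta by rewrite -ltr_expR -hE.
  (* The factor divides the member at j + 1, so h is at most the height of that member. At this
     height the value of [a j] is already small and u/v is close to z, which makes the integer F j
     smaller than 1. *)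
  have step j : (j <= i)%N -> F j.+1 = 0 -> F j = 0.
    move=> ji /Fh; rewrite hE ler_expR => hj.
    have xi : x j.+1 <= x i.+1 by apply: (ms_le ms).
    have Fint : F j \is a Num.int.
      by rewrite /F !rpredD // rpredM ?rpredX ?rpredM //; apply: (ms_int ms).
    apply: int_norm_lt1 => //.
    have bF : `|F j| <= h ^+ 2 * `|eval2 z (a j)| + l * (expR (x j) * (2 * Z * h)).
      rewrite /F (eval_lincomb z); apply: ler_normDD.
        rewrite normrM normrX ler_wpM2r //.
        by rewrite ler_sqr ?nnegrE //; lra.
      apply: ler_normM => //.
      have -> : expR (x j) * (2 * Z * h) =
        expR (x j) * h + expR (x j) * (h * (1 + `|z|) + h * `|z|).
        by rewrite /Z; ring.
      apply: ler_normDD; apply: ler_normM; rewrite ?(ms_bounded ms) //.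
      apply: (@le_trans _ _ (h + h * `|z|)); last first.
        have : 0 <= h * `|z| by rewrite mulr_ge0 // ltW.
        lra.
      by apply: ler_normDD => //; apply: ler_normM.
    apply: le_lt_trans bF _.
    have t1 : h ^+ 2 * `|eval2 z (a j)| <= 2 * expR ((2 - w) * eta).
      rewrite hE -expRM_natl.
      apply: (@le_trans _ _ (expR (2 * eta) * (2 * expR (- w * x j.+1)))).
        by rewrite ler_wpM2l ?expR_ge0 // (ms_exponent ms).
      rewrite mulrCA -expRD ler_wpM2l // ler_expR; nra.
    have t2 : l * (expR (x j) * (2 * Z * h)) <= 8 * Z ^+ 2 * expR ((2 - w) * eta).
      apply: (@le_trans _ _ (2 * Z * (expR (x i.+1) * (4 * Z * expR ((1 - w) * x i.+1))))).
        have -> : l * (expR (x j) * (2 * Z * h)) = 2 * Z * (expR (x j) * (l * h)) by ring.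
        rewrite ler_wpM2l //; first by lra.
        apply: ler_pM lh; [exact: expR_ge0 | exact: mulr_ge0 l0 (ltW h0) |].
        by rewrite ler_expR (ms_le ms) // leqW.
      have -> : 2 * Z * (expR (x i.+1) * (4 * Z * expR ((1 - w) * x i.+1))) =
         8 * Z ^+ 2 * (expR (x i.+1) * expR ((1 - w) * x i.+1)) by ring.
      rewrite -expRD ler_wpM2l //; first by nra.
      rewrite ler_expR; nra.
    have t3 : C * expR ((2 - w) * eta) < 1.
      have -> : (2 - w) * eta = - ((w - 2) * eta) by ring.
      rewrite expRN ltr_pdivrMr ?expR_gt0 // mul1r.
      apply: lt_le_trans (expR_ge1Dx _).
      have : T * (w - 2) = C by rewrite /T divfK //; lra.
      nra.
    move: t3; rewrite /C; lra.
  have F0 : F 0%N = 0 := descending_ind Fi step.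
  have h0' := Fh _ F0.
  by move: hK; rewrite ltNge => /negP; apply; apply: le_trans h0' _;
    rewrite ler_expR le_max lexx orbT.
(* The factor, read as a quadratic of height at most n, has value at least c at z; for i >= i0 this
   contradicts [lh]. *)
pose b (j : nat) : R := match j with 0%N => u | 1%N => - v | _ => 0 end.
have cl : c <= l.
  have -> : l = `|eval2 z b| by rewrite /l /eval2 /b; congr `|_|; ring.
  apply: hc.
  - by case=> [|[|j]]; rewrite /b ?rpredN ?rpred0.
  - move=> [b0 b1 _]; apply: uv0; split=> //.
    by apply/eqP; rewrite -oppr_eq0; apply/eqP.
  have hn : h <= n%:R by apply: le_trans nK.
  by case=> [|[|j]]; rewrite /b ?normrN ?normr0 // (le_trans _ hn).
have lt : l < c; last by lra.
have l_le : l <= 4 * Z * expR ((1 - w) * x i.+1) by apply: le_trans lh; rewrite ler_peMr.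
apply: le_lt_trans l_le _.
have -> : (1 - w) * x i.+1 = - ((w - 1) * x i.+1) by ring.
rewrite expRN ltr_pdivrMr ?expR_gt0 //.
have xi : x i0 <= x i.+1 by apply: (ms_le ms); apply: leq_trans ii0 (leqnSn i).
have e1 := expR_ge1Dx ((w - 1) * x i.+1).
have e2 : 4 * Z / c <= (w - 1) * x i.+1.
  have w1 : 0 < w - 1 by lra.
  by rewrite [leRHS]mulrC -ler_pdivrMr // (le_trans hi0).
have e3 : 4 * Z = c * (4 * Z / c) by field; lra.
nra.
Qed.

End MinSeq.

(** * Existence of minimal sequences *)

Section MinSeqExistence.
Context {R : realType}.
Implicit Types (z w tau : R).

Lemma int_norm_ltn (y : R) (n : nat) : y \is a Num.int -> `|y| < n.+1%:R ->
  `|y| <= n%:R.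
Proof.
move=> /intrP[m ->]; rewrite -intr_norm -[n.+1%:R]/(n.+1%:Z%:~R).
by rewrite -[n%:R]/(n%:Z%:~R) ltr_int ler_int; lia.
Qed.

Lemma eval2_nonzero z a : eval2 z a != 0 -> nonzero3 a.
Proof.
by move=> /eqP e [a0 a1 a2]; apply: e; rewrite /eval2 a0 a1 a2; ring.
Qed.

Definition uniform2 z w : Prop := exists B : R, forall y, B < y ->
  exists a, [/\ int_vec a, bounded_by (expR y) a
    & 0 < `|eval2 z a| <= expR (- w * y)].

Definition admissible z tau (n : nat) (a : nat -> R) : Prop :=
  [/\ int_vec a, bounded_by n%:R a & 0 < `|eval2 z a| <= tau].

(** n is the least height at which a nonzero value of size at most tau occurs; the last clause is
    what the uniform exponent says about it. *)
Definition best z w tau (n : nat) (a : nat -> R) : Prop :=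
  [/\ admissible z tau n a,
      forall m b, admissible z tau m b -> (n <= m)%N
    & w * ln n%:R <= - ln tau].

Lemma admissible_gt0 z tau n a : admissible z tau n a -> (0 < n)%N.
Proof.
case=> ia ba /andP[e0 _]; rewrite lt0n; apply/eqP => n0.
have a0 i : a i = 0.
  by apply/eqP; rewrite -normr_le0; have := ba i; rewrite n0.
by move: e0; rewrite /eval2 !a0 !mul0r !addr0 normr0 ltxx.
Qed.

Lemma best_exists z w : 0 < w -> uniform2 z w ->
  exists2 tau0 : R, 0 < tau0 &
    forall tau, 0 < tau <= tau0 -> exists n a, best z w tau n a.
Proof.
move=> w0 [B hB]; exists (expR (- w * (`|B| + 1))); first exact: expR_gt0.
move=> tau /andP[t0 tB].
(* The logarithmic height at which the exponent w guarantees the value tau; [tau0] is chosen to make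
   it exceed B. *)
pose y := - ln tau / w.
have yB : B < y.
  rewrite /y ltr_pdivlMr //.
  have lnt : ln tau <= - w * (`|B| + 1).
    by rewrite -[leRHS]expRK ler_ln ?posrE ?expR_gt0.
  have := ler_norm B; nra.
have wy : - w * y = ln tau by rewrite /y; field; lra.
have [a [ia ba]] := hB _ yB; rewrite wy lnK ?posrE // => ea.
pose n := Num.trunc (expR y).
have ny : n%:R <= expR y by rewrite Num.Theory.truncn_le expR_ge0.
have adm : admissible z tau n a.
  split=> // i; apply: int_norm_ltn => //.
  by apply: le_lt_trans (ba i) _; apply: truncnS_gt.
have ex : exists n, `[< exists b, admissible z tau n b >].
  by exists n; apply/asboolP; exists a.
have [m /asboolP[b admb] mmin] := ex_minnP ex.
exists m, b; split=> //.
  by move=> k c admc; apply: mmin; apply/asboolP; exists c.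
have mn : (m <= n)%N by apply: mmin; apply/asboolP; exists a.
have my : m%:R <= expR y by apply: le_trans ny; rewrite ler_nat.
rewrite -wy mulNr opprK ler_pM2l // -[leRHS]expRK ler_ln ?posrE ?expR_gt0 //.
by rewrite ltr0n (admissible_gt0 admb).
Qed.

(** Greedy choice: each threshold is half the value just reached. A later member proportional to an
    earlier one would have ratio at most 1/2, hence a smaller height and an admissible value,
    against minimality. *)
Lemma min_seq_exists z w : 0 < w -> transcendental2 z -> uniform2 z w ->
  exists a x, min_seq z w a x.
Proof.
move=> w0 htr hu; have [tau0 tau00 hbest] := best_exists w0 hu.
have [|f hf] := @choice R (nat * (nat -> R))%type
  (fun tau p => 0 < tau <= tau0 -> best z w tau p.1 p.2).
  move=> tau; have [h|h] := pselect (0 < tau <= tau0); last by exists (0%N, fun=> 0).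
  by have [n [a ha]] := hbest _ h; exists (n, a).
pose s := fix s (i : nat) : R :=
  if i is j.+1 then `|eval2 z (f (s j)).2| / 2 else tau0.
pose a i := (f (s i)).2; pose n i := (f (s i)).1.
have sS i : s i.+1 = `|eval2 z (a i)| / 2 by [].
have s_ok i : 0 < s i <= tau0.
  elim: i => [|i /[dup] IH /andP[si0 si1]]; first by rewrite /= tau00 lexx.
  have [[_ _ /andP[e0 e1]] _ _] := hf _ IH.
  rewrite sS /a; apply/andP; split; lra.
have hb i : best z w (s i) (n i) (a i) := hf _ (s_ok i).
have e_gt0 i : 0 < `|eval2 z (a i)| by have [[_ _ /andP[]]] := hb i.
have e_le i : `|eval2 z (a i)| <= s i by have [[_ _ /andP[]]] := hb i.
have int_a i : int_vec (a i) by have [[]] := hb i.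
have bnd_a i : bounded_by (n i)%:R (a i) by have [[]] := hb i.
have n_gt0 i : (0 < n i)%N by have [/admissible_gt0] := hb i.
have n_pos i : 0 < (n i)%:R :> R by rewrite ltr0n.
have nE i : expR (ln (n i)%:R) = (n i)%:R :> R by rewrite lnK ?posrE.
have half i : `|eval2 z (a i.+1)| <= `|eval2 z (a i)| / 2.
  by rewrite -sS e_le.
have half_lt i j : (i < j)%N -> `|eval2 z (a j)| <= `|eval2 z (a i)| / 2.
  elim: j => // j IH; rewrite ltnS leq_eqVlt => /orP[/eqP<-|/IH h]; first exact: half.
  have := half j; have := e_gt0 j; have := e_gt0 j.+1; lra.
have mini i m b : admissible z (s i) m b -> (n i <= m)%N.
  by have [_ h _] := hb i; apply: h.
exists a, (fun i => ln (n i)%:R); split=> //.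
- by move=> i j; rewrite nE bnd_a.
- by move=> i; rewrite ln_ge0 // ler1n.
- move=> i; rewrite ler_ln ?posrE // ler_nat; apply: (mini i _ (a i.+1)).
  split=> //; rewrite e_gt0 /=; apply: le_trans (half i) _.
  have := e_le i; have := e_gt0 i; lra.
- move=> i; have [_ _] := hb i.+1; rewrite sS => h.
  have : ln (`|eval2 z (a i)| / 2) <= - w * ln (n i.+1)%:R by lra.
  rewrite -ler_expR lnK ?posrE; first by lra.
  by have := e_gt0 i; lra.
- move=> i j ij [c0 c1 c2].
  have [||||| r r0 [b0 b1 b2]] := @parallel_of_minors _ (a i) (a j).
  + by apply: (@eval2_nonzero z); rewrite -normr_gt0.
  + by apply: (@eval2_nonzero z); rewrite -normr_gt0.
  + by move: c2; rewrite /cross; lra.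
  + by move: c1; rewrite /cross; lra.
  + by move: c0; rewrite /cross; lra.
  have er : eval2 z (a j) = r * eval2 z (a i).
    by rewrite /eval2 b0 b1 b2; ring.
  have r2 : `|r| <= 2^-1.
    by have := half_lt _ _ ij; rewrite er normrM mulrC ler_pM2l.
  (* Proportionality only controls the entries 0, 1, 2, while admissibility concerns all of them;
     the others are set to 0. *)
  pose b (k : nat) : R := if (k < 3)%N then a j k else 0.
  suff /mini : admissible z (s i) (n i).-1 b by rewrite leqNgt prednK // leqnn.
  have ib : int_vec b.
    by move=> k; rewrite /b; case: ifP => _; [apply: int_a | apply: rpred0].
  split=> //.
    move=> k; apply: int_norm_ltn => //.
    rewrite prednK // /b; case: ifP; last by rewrite normr0.
    have small c : `|r * a i c| < (n i)%:R.
      have := bnd_a i c; have := n_pos i; rewrite normrM; set A := `|a i c|.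
      have A0 : 0 <= A by rewrite normr_ge0.
      have := ler_wpM2r A0 r2; lra.
    by case: k => [|[|[|k]]] // _; rewrite ?b0 ?b1 ?b2.
  have -> : eval2 z b = eval2 z (a j) by [].
  rewrite e_gt0 /=; apply: le_trans (half_lt _ _ ij) _.
  have := e_le i; have := e_gt0 i; lra.
move=> T; apply: contrapT => hT.
have xT i : ln (n i)%:R < T.
  by rewrite ltNge; apply/negP => h; apply: hT; exists i.
pose K := (Num.trunc (expR T)).+1.
have nK i : (n i)%:R <= K%:R :> R.
  by rewrite -nE ltW // (lt_trans _ (truncnS_gt _)) // ltr_expR.
have [c c0 hc] := bounded_eval_lower K htr.
have ce i : c <= `|eval2 z (a i)|.
  apply: hc => //; first by apply: (@eval2_nonzero z); rewrite -normr_gt0.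
  by move=> j; apply: le_trans (bnd_a i j) (nK i).
(* Weaker than geometric decay, but it already brings the values below c. *)
have dec i : `|eval2 z (a i)| * i.+1%:R <= `|eval2 z (a 0%N)|.
  elim: i => [|i IH]; first by rewrite mulr1.
  apply: le_trans IH; have := half i; have := e_gt0 i.
  rewrite -[i.+2]addn1 -[i.+1]addn1 !natrD; have : 0 <= i%:R :> R by [].
  set I := i%:R; set p := `|_|; set q := `|_|; nra.
pose i := Num.trunc (`|eval2 z (a 0%N)| / c).
have := dec i; have := ce i.
have : `|eval2 z (a 0%N)| / c < i.+1%:R by apply: truncnS_gt.
rewrite ltr_pdivrMr //; have : 0 < i.+1%:R :> R by [].
set I := _%:R; set p := `|_|; set q := `|_|; nra.
Qed.

End MinSeqExistence.

(** * The golden-ratio sequence *)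

Section Golden.
Context {R : realType}.

Definition golden : R := (1 + Num.sqrt 5) / 2.

Lemma golden_sqr : golden * golden = golden + 1.
Proof.
have := @sqr_sqrtr R 5 (ler0n _ _); rewrite /golden expr2; set s := Num.sqrt 5.
by move=> h; lra.
Qed.

(** Quotients of consecutive Fibonacci numbers; with [golden_sqr] they replace the surd in the
    linear arithmetic. *)
Lemma golden_bounds : 21 / 13 < golden < 34 / 21.
Proof.
have := golden_sqr; have : 1 < golden.
  have : 2 <= Num.sqrt (5 : R).
    by rewrite -(ger0_norm (ler0n R 2)) -sqrtr_sqr ler_wsqrtr //; lra.
  by rewrite /golden; lra.
set g := golden => g1 gg; apply/andP; split; rewrite ltNge; apply/negP; nra.
Qed.

Lemma sqrt5_golden : Num.sqrt 5 = 2 * golden - 1 :> R.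
Proof. by rewrite /golden; field. Qed.

End Golden.

Arguments golden {R}.

(** * Extraction of the golden-ratio sequence from the minimal quadratics *)

Section RoySeq.
Context {R : realType}.
Implicit Types (z w eps T : R).

(** Deliberately crude, with C in place of ln C: constants are absorbed later anyway. *)
Lemma expR_ge1_ge (C A : R) : 1 <= C * expR A -> - C <= A.
Proof.
move=> h; have C0 : 0 < C.
  by rewrite -(pmulr_lgt0 C (expR_gt0 A)); lra.
have : 1 <= expR C * expR A.
  apply: le_trans h _; rewrite ler_wpM2r ?expR_ge0 //.
  by apply: le_trans (expR_ge1Dx C); lra.
by rewrite -expRD -[leLHS]expR0 ler_expR; lra.
Qed.

(* [t k] bounds the logarithm of the height of [Q k], and [2 * golden + 1] is
   the cube of [golden]. *)
Record roy_seq z eps T (Q : nat -> nat -> R) (t : nat -> R) : Prop := RoySeq {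
  rs_int : forall k, int_vec (Q k);
  rs_bounded : forall k, bounded_by (expR (t k)) (Q k);
  rs_start : forall k, T <= t k;
  rs_growth : forall k, (golden - eps) * t k <= t k.+1 <= (golden + eps) * t k;
  rs_eval : forall k,
    expR (- (2 * golden + 1 + eps) * t k) <= `|eval2 z (Q k)|
      <= expR (- (2 * golden + 1 - eps) * t k);
  rs_disc : forall k, disc (cross (Q k) (Q k.+1)) != 0 }.

Lemma perp_parallel (a b N : nat -> R) : nonzero3 N -> nonzero3 (cross a b) ->
  a 0%N * N 0%N + a 1%N * N 1%N + a 2%N * N 2%N = 0 ->
  b 0%N * N 0%N + b 1%N * N 1%N + b 2%N * N 2%N = 0 ->
  parallel N (cross a b).
Proof.
move=> hN hc aN bN; apply: parallel_of_minors => //; apply/eqP; rewrite -subr_eq0.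
- have -> : N 0%N * cross a b 1 - N 1%N * cross a b 0 =
    a 2%N * (b 0%N * N 0%N + b 1%N * N 1%N + b 2%N * N 2%N)
    - b 2%N * (a 0%N * N 0%N + a 1%N * N 1%N + a 2%N * N 2%N).
    by rewrite /cross; ring.
  by rewrite aN bN !mulr0 subr0.
- have -> : N 0%N * cross a b 2 - N 2%N * cross a b 0 =
    b 1%N * (a 0%N * N 0%N + a 1%N * N 1%N + a 2%N * N 2%N)
    - a 1%N * (b 0%N * N 0%N + b 1%N * N 1%N + b 2%N * N 2%N).
    by rewrite /cross; ring.
  by rewrite aN bN !mulr0 subr0.
have -> : N 1%N * cross a b 2 - N 2%N * cross a b 1 =
  a 0%N * (b 0%N * N 0%N + b 1%N * N 1%N + b 2%N * N 2%N)
  - b 0%N * (a 0%N * N 0%N + a 1%N * N 1%N + a 2%N * N 2%N).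
  by rewrite /cross; ring.
by rewrite aN bN !mulr0 subr0.
Qed.

Lemma ms_eval_mono z w a x : min_seq z w a x -> forall i,
  `|eval2 z (a i.+1)| <= `|eval2 z (a i)|.
Proof. by move=> ms i; have := ms_half ms i; have := ms_pos ms i; lra. Qed.

(** The nonzero integer determinant is at most 6 |a_i(z)| X_(i+1) X_(i+2), with X the heights;
    [ms_exponent] doubles the constant to 12. *)
Lemma ms_triple z w a x i : min_seq z w a x ->
  det3 (a i) (a i.+1) (a i.+2) != 0 -> (w - 1) * x i.+1 <= x i.+2 + 12.
Proof.
move=> ms d0.
have := norm_intr_ge1 (int_det3 (ms_int ms i) (ms_int ms i.+1) (ms_int ms i.+2)) d0.
have := norm_det3 (ms_bounded ms i) (ms_bounded ms i.+1) (ms_bounded ms i.+2)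
  (lexx _) (ms_eval_mono ms i) (le_trans (ms_eval_mono ms i.+1) (ms_eval_mono ms i)).
move=> /[swap] /le_trans/[apply].
have := ms_exponent ms i.
set p := `|eval2 z (a i)|; have p0 : 0 <= p by rewrite normr_ge0.
have X0 := expR_gt0 (x i); have X1 := expR_gt0 (x i.+1); have X2 := expR_gt0 (x i.+2).
have X01 : expR (x i) <= expR (x i.+1) by rewrite ler_expR (ms_mono ms).
have X12 : expR (x i.+1) <= expR (x i.+2) by rewrite ler_expR (ms_mono ms).
move=> pe h.
have h2 : 1 <= 6 * (p * (expR (x i.+1) * expR (x i.+2))).
  apply: le_trans h _; rewrite -!mulrA.
  have k1 : expR (x i) * expR (x i.+2) <= expR (x i.+1) * expR (x i.+2).
    by rewrite ler_wpM2r // ltW.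
  have k2 : expR (x i) * expR (x i.+1) <= expR (x i.+1) * expR (x i.+2).
    by rewrite ler_pM // ltW.
  have := ler_wpM2l p0 k1; have := ler_wpM2l p0 k2; lra.
have h3 : 1 <= 12 * expR (- w * x i.+1 + (x i.+1 + x i.+2)).
  apply: le_trans h2 _; rewrite !expRD.
  have Y0 : 0 <= expR (x i.+1) * expR (x i.+2) by rewrite mulr_ge0 // ltW.
  have := ler_wpM2r Y0 pe; lra.
have := expR_ge1_ge h3; lra.
Qed.

(** Serves twice: with [ms_exponent] it bounds x_(i+1) in terms of x_i, and alone it bounds |a_i(z)|
    from below. *)
Lemma ms_resultant z w a x i : min_seq z w a x ->
  disc (cross (a i) (a i.+1)) != 0 ->
  1 <= 8 * (1 + `|z|) * (`|eval2 z (a i)| * expR (x i + 2 * x i.+1)).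
Proof.
move=> ms d0.
have iN := int_vec_cross (ms_int ms i) (ms_int ms i.+1).
apply: le_trans (norm_intr_ge1 (int_disc iN) d0) _.
apply: le_trans (norm_disc z (bounded_cross (ms_bounded ms i) (ms_bounded ms i.+1))) _.
have h := ms_drift ms i.
have X0 : 0 <= 2 * (2 * (expR (x i) * expR (x i.+1))) by rewrite !mulr_ge0 ?expR_ge0.
have -> : x i + 2 * x i.+1 = x i + x i.+1 + x i.+1 by ring.
rewrite !expRD; have := ler_wpM2l X0 h; lra.
Qed.

(** In [parallel_drift] the size is taken at i and the drift at j. So a plane first spanned at small
    height cannot persist to large height. *)
Lemma ms_parallel z w a x i j : min_seq z w a x ->
  disc (cross (a i) (a i.+1)) != 0 ->
  parallel (cross (a i) (a i.+1)) (cross (a j) (a j.+1)) ->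
  (w - 1) * x j.+1 <= x i + x i.+1 + 32 * (1 + `|z|).
Proof.
move=> ms d0 par.
have iN := int_vec_cross (ms_int ms i) (ms_int ms i.+1).
have iM := int_vec_cross (ms_int ms j) (ms_int ms j.+1).
have bN := bounded_cross (ms_bounded ms i) (ms_bounded ms i.+1).
have h := parallel_drift z iN iM bN par d0.
have h1 := ms_drift ms j; have h2 := ms_exponent ms j.
have X0 : 0 <= expR (x i) * expR (x i.+1) by rewrite !mulr_ge0 ?expR_ge0.
have Y0 : 0 <= (1 + `|z|) * expR (x j.+1) by rewrite !mulr_ge0 ?addr_ge0 ?expR_ge0.
have h3 : drift z (cross (a j) (a j.+1)) <=
  4 * ((1 + `|z|) * (expR (x j.+1) * expR (- w * x j.+1))).
  have := ler_wpM2l Y0 h2; lra.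
have h4 : 1 <= 32 * (1 + `|z|) * expR (x i + x i.+1 + (x j.+1 + - w * x j.+1)).
  rewrite !expRD; have := ler_wpM2l X0 h3; lra.
have := expR_ge1_ge h4; lra.
Qed.

Lemma ms_parallel_upto z w a x i j : min_seq z w a x -> (i <= j)%N ->
  (forall k, (i <= k < j)%N -> det3 (a k) (a k.+1) (a k.+2) = 0) ->
  parallel (cross (a i) (a i.+1)) (cross (a j) (a j.+1)).
Proof.
move=> ms ij; rewrite -(subnK ij); elim: (j - i)%N => [|k IH] h.
  exact: parallel_refl.
rewrite addSn; apply: (@parallel_trans _ _ (cross (a (k + i)%N) (a (k + i).+1))).
  by apply: IH => m /andP[im mk]; apply: h; rewrite im addSn ltnS ltnW.
apply: parallel_cross; [exact: (ms_indep ms) | exact: (ms_indep ms) |].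
by apply: h; rewrite leq_addl addSn ltnSn.
Qed.

(** If the plane spanned by neighbours never changed, [ms_parallel] would bound all heights. j is
    the first place where it changes. *)
Lemma ms_next z w a x i : 1 < w -> min_seq z w a x ->
  disc (cross (a i.+1) (a i.+2)) != 0 ->
  exists j, [/\ (i < j)%N, det3 (a j) (a j.+1) (a j.+2) != 0
    & parallel (cross (a i.+1) (a i.+2)) (cross (a j) (a j.+1))].
Proof.
move=> w1 ms d0.
have ex : exists j, (i < j)%N && (det3 (a j) (a j.+1) (a j.+2) != 0).
  apply: contrapT => hn.
  have par j : (i < j)%N -> parallel (cross (a i.+1) (a i.+2)) (cross (a j) (a j.+1)).
    move=> ij; apply: (ms_parallel_upto ms ij) => k /andP[ik _].
    apply/eqP; apply: contrapT => /negP h; apply: hn; exists k.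
    by rewrite ik.
  set C := x i.+1 + x i.+2 + 32 * (1 + `|z|).
  have [k hk] := ms_unbounded ms (C / (w - 1) + 1).
  have h := ms_parallel ms d0 (par (maxn i.+1 k) (leq_maxl _ _)).
  have xk : x k <= x (maxn i.+1 k).+1.
    by apply: (ms_le ms); apply: leqW; apply: leq_maxr.
  have w10 : 0 < w - 1 by lra.
  have h' : x (maxn i.+1 k).+1 <= C / (w - 1) by rewrite ler_pdivlMr // mulrC.
  lra.
have [j /andP[ij dj] jmin] := ex_minnP ex.
exists j; split=> //; apply: (ms_parallel_upto ms ij) => k /andP[ik kj].
apply/eqP; apply: contraTT kj => dk; rewrite -leqNgt; apply: jmin.
by rewrite ik.
Qed.

(* [t] and [t'] are the logarithmic heights of two consecutive members of the
   extracted sequence, [m] that of the minimal point following the first one. *)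
Lemma roy_arith (k K t m t' : R) : 0 < k /\ 20 * k <= 1 / 20 -> 1 <= K ->
  K <= k * t ->
  let w := golden + 1 - k in
  (w - 1) * t <= m + K -> (w - 2) * m <= t + K -> m <= t' ->
  (w - 1) * t' <= t + m + K ->
  [/\ (golden - 20 * k) * t <= t', t' <= (golden + 20 * k) * t,
      (2 * golden + 1 - 20 * k) * t + 1 <= w * m
    & K + t + 2 * m <= (2 * golden + 1 + 20 * k) * t].
Proof.
move=> [kp k1] K1 kt w.
(* For k = K = 0 the hypotheses read g t <= m, (g - 1) m <= t, m <= t' and g t' <= t + m. Since g (g
   - 1) = 1, they force m = t' = g t. The rest tracks the errors, K being absorbed by k t. *)
have gg := @golden_sqr R; have /andP[g1 g2] := @golden_bounds R.
rewrite /w {w}; set g := golden in gg g1 g2 *.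
move=> hA hB hm hG.
have t0 : 0 < t by rewrite -(pmulr_rgt0 _ kp); lra.
have tK : 0 < t + K by lra.
have mle : m <= (g + 6 * k) * (t + K).
  have h1 : m * (1 - g * k) <= g * (t + K).
    have -> : m * (1 - g * k) = g * ((g + 1 - k - 2) * m).
      transitivity (m * (g * g) - m * g - m * g * k); last by ring.
      by rewrite gg; ring.
    by rewrite ler_wpM2l //; lra.
  have h2 : 0 < 1 - g * k by nra.
  rewrite -(ler_pM2r h2); apply: le_trans h1 _.
  have -> : (g + 6 * k) * (t + K) * (1 - g * k) =
    (g + 6 * k) * (1 - g * k) * (t + K) by ring.
  by rewrite ler_pM2r //; nra.
have mle' : m <= (g + 8 * k) * t by nra.
have mge : (g - 2 * k) * t <= m by lra.
split.
- by nra.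
- have h2 : 0 < g - k by lra.
  rewrite -(ler_pM2r h2); have : t' * (g - k) <= t + (g + 8 * k) * t + k * t by lra.
  move/le_trans; apply.
  have -> : (g + 20 * k) * t * (g - k) = (g + 20 * k) * (g - k) * t by ring.
  have -> : t + (g + 8 * k) * t + k * t = (1 + g + 9 * k) * t by ring.
  by rewrite ler_pM2r //; nra.
- have h1 : (g + 1 - k) * ((g - 2 * k) * t) <= (g + 1 - k) * m.
    by rewrite ler_pM2l //; lra.
  apply: le_trans h1.
  have -> : (g + 1 - k) * ((g - 2 * k) * t) =
     ((g + 1 - k) * (g - 2 * k)) * t by ring.
  have : (2 * g + 1 - 20 * k) * t + k * t <= ((g + 1 - k) * (g - 2 * k)) * t.
    by rewrite -mulrDl ler_pM2r //; nra.
  lra.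
by lra.
Qed.

(** Each [Q k] is the middle member of an independent triple, where the plane spanned by neighbours
    changes. Between two such places the plane is constant, hence spanned by [Q k] and its
    successor, which inherit the nonzero discriminant. *)
Lemma roy_seq_exists z : transcendental2 z ->
  (forall w, w < golden + 1 -> uniform2 z w) ->
  forall eps T, 0 < eps <= 1 / 20 -> exists Q t, roy_seq z eps T Q t.
Proof.
move=> htr hu eps T heps; have /andP[eps0 eps1] := heps.
have /andP[g1 g2] := @golden_bounds R.
(* [roy_arith] turns a defect k of the exponent into an error 20 k. *)
pose w : R := golden + 1 - eps / 20.
have w2 : 2 < w by rewrite /w; lra.
have hw : uniform2 z w by apply: hu; rewrite /w; lra.
have [|a [x ms]] := @min_seq_exists _ z w _ htr hw; first by lra.
have [i0 cop] := ms_coprime w2 htr ms.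
pose K := 32 * (1 + `|z|).
have K32 : 32 <= K by rewrite /K; have := normr_ge0 z; lra.
(* Above T' the constant K is at most (eps / 20) times the logarithmic height. *)
pose T' := Num.max T (20 * K / eps).
have [i1 hi1] := ms_unbounded ms T'.
pose good i := [/\ (maxn i0 i1 <= i)%N & det3 (a i) (a i.+1) (a i.+2) != 0].
have good_next i : (maxn i0 i1 <= i)%N -> exists j, [/\ (i < j)%N, good j
    & parallel (cross (a i.+1) (a i.+2)) (cross (a j) (a j.+1))].
  move=> i01.
  have d0 : disc (cross (a i.+1) (a i.+2)) != 0.
    by apply: cop; apply: leqW; apply: leq_trans i01; apply: leq_maxl.
  have [|j [ij dj par]] := ms_next _ ms d0; first by lra.
  by exists j; split=> //; split=> //; apply: leq_trans i01 (ltnW ij).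
have [|f hf] := @choice nat nat (fun i j => (maxn i0 i1 <= i)%N -> [/\ (i < j)%N, good j
    & parallel (cross (a i.+1) (a i.+2)) (cross (a j) (a j.+1))]).
  move=> i; have [h|h] := boolP (maxn i0 i1 <= i)%N; last by exists 0%N.
  by have [j hj] := good_next _ h; exists j.
pose s k := iter k f (f (maxn i0 i1)).
have s_good k : good (s k).
  elim: k => [|k [IH _]]; first by have [] := hf _ (leqnn _).
  by have [] := hf _ IH.
have sS k : [/\ (s k < s k.+1)%N &
    parallel (cross (a (s k).+1) (a (s k).+2)) (cross (a (s k.+1)) (a (s k.+1).+1))].
  by have [h _] := s_good k; have [] := hf _ h.
have dsc k : disc (cross (a (s k).+1) (a (s k).+2)) != 0.
  have [h _] := s_good k; apply: cop; apply: leqW; apply: leq_trans h.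
  exact: leq_maxl.
have xT k : T' <= x (s k).+1.
  apply: le_trans hi1 _; apply: (ms_le ms); have [h _] := s_good k.
  by apply: leqW; apply: leq_trans h; apply: leq_maxr.
have heps' : 0 < eps / 20 /\ 20 * (eps / 20) <= 1 / 20 by split; lra.
have main k := @roy_arith (eps / 20) K (x (s k).+1) (x (s k).+2) (x (s k.+1).+1) heps'.
have e20 : 20 * (eps / 20) = eps by field.
have {}main k : [/\ (golden - eps) * x (s k).+1 <= x (s k.+1).+1,
  x (s k.+1).+1 <= (golden + eps) * x (s k).+1,
  (2 * golden + 1 - eps) * x (s k).+1 + 1 <= w * x (s k).+2
  & K + x (s k).+1 + 2 * x (s k).+2 <= (2 * golden + 1 + eps) * x (s k).+1].
  have [ss par] := sS k; have [_ dk] := s_good k.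
  rewrite -e20; apply: main.
  - by lra.
  - rewrite mulrC -ler_pdivrMr; last by lra.
    apply: le_trans (xT k); rewrite le_max; apply/orP; right.
    by rewrite invf_div mulrCA mulrA.
  - by rewrite -/w; have := ms_triple ms dk; lra.
  - rewrite -/w; have h1 := ms_resultant ms (dsc k).
    have h2 := ms_exponent ms (s k).+1.
    have h3 : 1 <= 16 * (1 + `|z|) *
        expR (- w * x (s k).+2 + (x (s k).+1 + 2 * x (s k).+2)).
      rewrite expRD; have Y0 : 0 <= (1 + `|z|) * expR (x (s k).+1 + 2 * x (s k).+2).
        by rewrite mulr_ge0 ?addr_ge0 ?expR_ge0.
      have := ler_wpM2r Y0 h2; lra.
    have := expR_ge1_ge h3; move: K32; rewrite /K; lra.
  - exact: (ms_le ms).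
  by rewrite -/w; have := ms_parallel ms (dsc k) par; rewrite /K; lra.
exists (fun k => a (s k).+1), (fun k => x (s k).+1); split.
- by move=> k; apply: (ms_int ms).
- by move=> k; apply: (ms_bounded ms).
- by move=> k; apply: le_trans (xT k); rewrite le_max lexx.
- by move=> k; have [-> ->] := main k.
- move=> k; have [_ _ m1 m2] := main k; apply/andP; split.
    have h1 := ms_resultant ms (dsc k).
    set E := x (s k).+1 + 2 * x (s k).+2 in h1.
    have h2 : expR (- K - E) <= `|eval2 z (a (s k).+1)|.
      have EK : 8 * (1 + `|z|) <= expR K.
        apply: le_trans (expR_ge1Dx _); move: K32; rewrite /K; lra.
      have -> : - K - E = - (K + E) by ring.
      rewrite expRN -div1r ler_pdivrMr ?expR_gt0 // expRD.
      apply: le_trans h1 _; rewrite [leLHS]mulrC -[leLHS]mulrA.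
      rewrite ler_wpM2l //; rewrite mulrC ler_wpM2r ?expR_ge0 //.
    apply: le_trans h2; rewrite ler_expR /E; lra.
  apply: le_trans (ms_exponent ms _) _.
  (* The summand 1 reserved in [roy_arith] pays for the factor 2 of [ms_exponent]. *)
  have -> : - (2 * golden + 1 - eps) * x (s k).+1 =
    1 + - ((2 * golden + 1 - eps) * x (s k).+1 + 1) by ring.
  rewrite expRD ler_pM ?expR_ge0 //.
    by apply: le_trans (expR_ge1Dx _); lra.
  by rewrite ler_expR mulNr lerN2.
(* The next [Q] lies in the plane of the minimal points at (s k).+1 and (s k).+2, so both cross
   products are normal to the same plane. *)
move=> k; have [ss par] := sS k.
apply: disc_parallel (dsc k); apply: perp_parallel.
- exact: (ms_indep ms).
- by apply: (ms_indep_lt ms); rewrite ltnS.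
- by rewrite /cross; ring.
have [r r0 [p0 p1 p2]] := par; apply: (mulfI r0); rewrite mulr0.
rewrite mulrDr mulrDr !(mulrCA r) -p0 -p1 -p2.
by rewrite /cross; ring.
Qed.

End RoySeq.

(** * Cubic polynomials and rational approximation *)

Section Cubic.
Context {R : realType}.
Implicit Types (z u v X Y : R) (a b c d y : nat -> R).

(** Against [powers z] it is the value of the cubic a at z; against an integer point its vanishing
    means orthogonality. *)
Definition pair4 a y : R :=
  a 0%N * y 0%N + a 1%N * y 1%N + a 2%N * y 2%N + a 3%N * y 3%N.

Definition powers z : nat -> R := fun j => z ^+ j.

Definition minor3 a b c (i j k : nat) : R :=
  a i * (b j * c k - b k * c j) - a j * (b i * c k - b k * c i)
  + a k * (b i * c j - b j * c i).

Definition det4 a b c d : R :=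
  a 0%N * minor3 b c d 1 2 3 - a 1%N * minor3 b c d 0 2 3
  + a 2%N * minor3 b c d 0 1 3 - a 3%N * minor3 b c d 0 1 2.

(** With y = [powers z] it bounds determinants by values at z. With an integer point it shows that
    four independent cubics cannot all be orthogonal to y when y_0 is nonzero. *)
Lemma det4_column a b c d y : det4 a b c d * y 0%N =
  pair4 a y * minor3 b c d 1 2 3 - pair4 b y * minor3 a c d 1 2 3
  + pair4 c y * minor3 a b d 1 2 3 - pair4 d y * minor3 a b c 1 2 3.
Proof. by rewrite /det4 /minor3 /pair4; ring. Qed.

Lemma det4_cramer a b c d (p : nat -> R) (j : nat) : (j < 4)%N ->
  det4 a b c d * p j = det4 p b c d * a j + det4 a p c d * b j
  + det4 a b p d * c j + det4 a b c p * d j.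
Proof. by case: j => [|[|[|[|]]]] // _; rewrite /det4 /minor3; ring. Qed.

Lemma int_minor3 a b c i j k : int_vec a -> int_vec b -> int_vec c ->
  minor3 a b c i j k \is a Num.int.
Proof.
move=> ia ib ic; have h (f g : nat -> R) m n : int_vec f -> int_vec g ->
    f m * g n \is a Num.int by move=> hf hg; apply: rpredM.
by rewrite /minor3; apply: rpredD; first apply: rpredB;
  apply: rpredM => //; apply: rpredB; apply: h.
Qed.

Lemma int_det4 a b c d : int_vec a -> int_vec b -> int_vec c -> int_vec d ->
  det4 a b c d \is a Num.int.
Proof.
move=> ia ib ic id; rewrite /det4.
have h (f g k l : nat -> R) i m n p : int_vec f -> int_vec g -> int_vec k ->
    int_vec l -> f i * minor3 g k l m n p \is a Num.int.
  by move=> *; apply: rpredM => //; apply: int_minor3.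
apply: rpredB; last exact: h.
by apply: rpredD; [apply: rpredB; apply: h | apply: h].
Qed.

Lemma int_pair4 a y : int_vec a -> int_vec y -> pair4 a y \is a Num.int.
Proof. by move=> ia iy; rewrite /pair4 !rpredD // rpredM. Qed.

Lemma norm_minor3 X Y Z a b c i j k :
  bounded_by X a -> bounded_by Y b -> bounded_by Z c ->
  `|minor3 a b c i j k| <= 6 * (X * Y * Z).
Proof.
move=> ha hb hc.
have -> : 6 * (X * Y * Z) = X * (Y * Z + Y * Z) + X * (Y * Z + Y * Z)
  + X * (Y * Z + Y * Z) by ring.
rewrite /minor3; apply: ler_normDD; first apply: ler_normBB;
  by apply: ler_normM => //; apply: ler_normBB; apply: ler_normM.
Qed.

Lemma norm_det4 z X1 X2 X3 X4 A1 A2 A3 A4 a b c d :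
  bounded_by X1 a -> bounded_by X2 b -> bounded_by X3 c -> bounded_by X4 d ->
  `|pair4 a (powers z)| <= A1 -> `|pair4 b (powers z)| <= A2 ->
  `|pair4 c (powers z)| <= A3 -> `|pair4 d (powers z)| <= A4 ->
  `|det4 a b c d| <= 6 * (A1 * (X2 * X3 * X4) + A2 * (X1 * X3 * X4)
    + A3 * (X1 * X2 * X4) + A4 * (X1 * X2 * X3)).
Proof.
move=> ha hb hc hd eA eB eC eD.
have -> : det4 a b c d = pair4 a (powers z) * minor3 b c d 1 2 3
  - pair4 b (powers z) * minor3 a c d 1 2 3 + pair4 c (powers z) * minor3 a b d 1 2 3
  - pair4 d (powers z) * minor3 a b c 1 2 3.
  by rewrite -det4_column /powers expr0 mulr1.
have -> : 6 * (A1 * (X2 * X3 * X4) + A2 * (X1 * X3 * X4)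
    + A3 * (X1 * X2 * X4) + A4 * (X1 * X2 * X3)) =
  A1 * (6 * (X2 * X3 * X4)) + A2 * (6 * (X1 * X3 * X4))
  + A3 * (6 * (X1 * X2 * X4)) + A4 * (6 * (X1 * X2 * X3)) by ring.
apply: ler_normBB; last by apply: ler_normM => //; apply: norm_minor3.
apply: ler_normDD; last by apply: ler_normM => //; apply: norm_minor3.
by apply: ler_normBB; apply: ler_normM => //; apply: norm_minor3.
Qed.

(* The cubic [(u + v T)(a_0 + a_1 T + a_2 T^2)]. *)
Definition linquad u v a : nat -> R := fun i =>
  match i with
  | 0%N => u * a 0%N
  | 1%N => u * a 1%N + v * a 0%N
  | 2%N => u * a 2%N + v * a 1%N
  | 3%N => v * a 2%N
  | _ => 0
  end.

Lemma int_linquad u v a : u \is a Num.int -> v \is a Num.int -> int_vec a ->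
  int_vec (linquad u v a).
Proof.
by move=> iu iv ia [|[|[|[|i]]]] /=; rewrite ?rpred0 ?rpredD // rpredM.
Qed.

Lemma bounded_linquad h X u v a : `|u| <= h -> `|v| <= h -> bounded_by X a ->
  bounded_by (2 * (h * X)) (linquad u v a).
Proof.
move=> hu hv ha.
have h0 : 0 <= h * X.
  by rewrite mulr_ge0 ?(le_trans _ hu) // (bounded_ge0 ha).
have -> : 2 * (h * X) = h * X + h * X by ring.
case=> [|[|[|[|i]]]] /=; last by rewrite normr0 addr_ge0.
- by rewrite -[_ * _]addr0; apply: ler_normDD; rewrite ?normr0 //; apply: ler_normM.
- by apply: ler_normDD; apply: ler_normM.
- by apply: ler_normDD; apply: ler_normM.
by rewrite -[v * _]addr0; apply: ler_normDD; rewrite ?normr0 //; apply: ler_normM.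
Qed.

Lemma eval_linquad z u v a :
  pair4 (linquad u v a) (powers z) = (u + v * z) * eval2 z a.
Proof. by rewrite /pair4 /linquad /powers /eval2; ring. Qed.

(** Sylvester's determinant of a, T a, b, T b after a change of basis in each pair, which
    contributes the two 2x2 determinants. *)
Lemma det4_linquad u v u' v' s t s' t' a b :
  det4 (linquad u v a) (linquad u' v' a) (linquad s t b) (linquad s' t' b) =
  - ((u * v' - u' * v) * (s * t' - s' * t) * disc (cross a b)).
Proof. by rewrite /det4 /minor3 /linquad /disc /cross; ring. Qed.

Lemma pair4_linquad u v a y : pair4 (linquad u v a) y =
  u * pair4 (linquad 1 0 a) y + v * pair4 (linquad 0 1 a) y.
Proof. by rewrite /pair4 /linquad; ring. Qed.

Lemma perp_linquad_neq0 a b y : disc (cross a b) != 0 -> y 0%N != 0 ->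
  ~ [/\ pair4 (linquad 1 0 a) y = 0, pair4 (linquad 0 1 a) y = 0,
        pair4 (linquad 1 0 b) y = 0 & pair4 (linquad 0 1 b) y = 0].
Proof.
move=> d0 y0 [p1 p2 p3 p4].
have := det4_column (linquad 1 0 a) (linquad 0 1 a) (linquad 1 0 b) (linquad 0 1 b) y.
rewrite p1 p2 p3 p4 !mul0r !subr0 addr0 det4_linquad => /eqP.
rewrite mulf_eq0 (negPf y0) orbF oppr_eq0 !mul0r !subr0 !mul1r.
by rewrite (negPf d0).
Qed.

(* [N] is read as the symmetric matrix [(N0, N1; N1, N2)], close to a multiple
   of [(1, z; z, z^2)]: it sends approximations of [z] to approximations of [z]. *)
Lemma symmetric_image z X N u v (h l : R) :
  bounded_by X N -> `|u| <= h -> `|v| <= h -> `|v - u * z| <= l ->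
  [/\ `|N 1%N * u - N 0%N * v| <= X * l + drift z N * h,
      `|N 2%N * u - N 1%N * v| <= X * l + drift z N * h
    & `|(N 2%N * u - N 1%N * v) - (N 1%N * u - N 0%N * v) * z|
        <= 2 * (drift z N * h)].
Proof.
move=> bN hu hv hl; have hl' : `|u * z - v| <= l by rewrite distrC.
split.
- have -> : N 1%N * u - N 0%N * v = N 0%N * (u * z - v) + (N 1%N - z * N 0%N) * u by ring.
  by apply: ler_normDD; apply: ler_normM; rewrite ?drift1.
- have -> : N 2%N * u - N 1%N * v = N 1%N * (u * z - v) + (N 2%N - z * N 1%N) * u by ring.
  by apply: ler_normDD; apply: ler_normM; rewrite ?drift2.
have -> : N 2%N * u - N 1%N * v - (N 1%N * u - N 0%N * v) * z =
  (N 2%N - z * N 1%N) * u - (N 1%N - z * N 0%N) * v by ring.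
have -> : 2 * (drift z N * h) = drift z N * h + drift z N * h by ring.
by apply: ler_normBB; apply: ler_normM; rewrite ?drift1 ?drift2.
Qed.

Lemma symmetric_image_neq0 N u v : disc N != 0 -> ~ (u = 0 /\ v = 0) ->
  ~ (N 1%N * u - N 0%N * v = 0 /\ N 2%N * u - N 1%N * v = 0).
Proof.
move=> d0 uv [e1 e2]; apply: uv.
have du : disc N * u = 0.
  have -> : disc N * u = N 0%N * (N 2%N * u - N 1%N * v) -
     N 1%N * (N 1%N * u - N 0%N * v) by rewrite /disc; ring.
  by rewrite e1 e2 !mulr0 subr0.
have dv : disc N * v = 0.
  have -> : disc N * v = N 1%N * (N 2%N * u - N 1%N * v) -
     N 2%N * (N 1%N * u - N 0%N * v) by rewrite /disc; ring.
  by rewrite e1 e2 !mulr0 subr0.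
by split; apply/eqP; [move/eqP: du | move/eqP: dv]; rewrite mulf_eq0 (negPf d0).
Qed.

End Cubic.

(** * Position of a height in the sequence and rational approximation to z *)

Section RoyConsequences.
Context {R : realType}.
Implicit Types (z eps T : R).

Lemma rs_mono z eps T Q t : eps <= 1 / 20 -> 1 <= T -> roy_seq z eps T Q t ->
  forall k, t k + 1 / 2 <= t k.+1.
Proof.
move=> e1 T1 rs k; have /andP[h _] := rs_growth rs k.
have := rs_start rs k; have /andP[g1 g2] := @golden_bounds R; nra.
Qed.

Lemma rs_unbounded z eps T Q t : eps <= 1 / 20 -> 1 <= T -> roy_seq z eps T Q t ->
  forall B, exists k, B <= t k.
Proof.
move=> e1 T1 rs B.
have h k : k%:R / 2 <= t k.
  elim: k => [|k IH]; first by have := rs_start rs 0; lra.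
  have := rs_mono e1 T1 rs k; have : k.+1%:R = k%:R + 1 :> R by rewrite natr1.
  by lra.
exists (Num.trunc (2 * `|B|)).+1; apply: le_trans (h _).
have := truncnS_gt (2 * `|B|); have := ler_norm B; lra.
Qed.

Lemma rs_locate z eps T Q t (c y : R) (k0 : nat) :
  eps <= 1 / 20 -> 1 <= T -> roy_seq z eps T Q t ->
  0 < c -> c * t k0 < y -> exists2 k, (k0 <= k)%N & c * t k < y <= c * t k.+1.
Proof.
move=> e1 T1 rs c0 hk0.
have ex : exists k, (k0 <= k)%N && (y <= c * t k.+1).
  have [k hk] := rs_unbounded e1 T1 rs (y / c).
  exists (maxn k0 k); rewrite leq_maxl /= mulrC -ler_pdivrMr //.
  apply: le_trans hk _.
  have mono i j : (i <= j)%N -> t i <= t j.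
    move=> ij; rewrite -(subnK ij); elim: (j - i)%N => //= m IH.
    by rewrite addSn; have := rs_mono e1 T1 rs (m + i); lra.
  by apply: mono; apply: leqW; apply: leq_maxr.
have [[|k] /andP[k0k hk] kmin] := ex_minnP ex.
  by exists 0%N => //; move: k0k hk0; rewrite leqn0 => /eqP -> ->.
exists k.+1 => //; rewrite hk andbT ltNge; apply/negP => yk.
move: k0k; rewrite leq_eqVlt => /orP[/eqP k0E|k0k].
  by move: hk0; rewrite k0E ltNge yk.
by have := kmin k; rewrite -ltnS k0k yk => /(_ isT); rewrite ltnn.
Qed.

Lemma rs_eval_le z eps T Q t : roy_seq z eps T Q t -> forall k,
  `|eval2 z (Q k)| <= expR (- (2 * golden + 1 - eps) * t k).
Proof. by move=> rs k; have /andP[] := rs_eval rs k. Qed.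

Lemma rs_cross z eps T Q t : 0 <= eps <= 1 / 20 -> 1 <= T -> roy_seq z eps T Q t ->
  forall k, bounded_by (2 * expR ((golden + 1 + eps) * t k)) (cross (Q k) (Q k.+1))
  /\ drift z (cross (Q k) (Q k.+1)) <=
     2 * (1 + `|z|) * expR (- (golden + 1 - 2 * eps) * t k).
Proof.
move=> /andP[e0 e1] T1 rs k.
have /andP[gl gu] := rs_growth rs k; have tm := rs_mono e1 T1 rs k.
have t1 := rs_start rs k.
have b1 := rs_bounded rs k; have b2 := rs_bounded rs k.+1.
have v1 := rs_eval_le rs k; have v2 := rs_eval_le rs k.+1.
split.
  move=> i; apply: le_trans (bounded_cross b1 b2 i) _.
  by rewrite ler_pM2l // -expRD ler_expR; lra.
apply: le_trans (drift_cross b1 b2 v1 v2) _.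
rewrite -!expRD; set E := expR (- (golden + 1 - 2 * eps) * t k).
have -> : 2 * (1 + `|z|) * E = (1 + `|z|) * (E + E) by ring.
rewrite ler_wpM2l ?addr_ge0 // /E.
have /andP[g1 g2] := @golden_bounds R.
apply: lerD; rewrite ler_expR; last by lra.
nra.
Qed.

(** If the form were too small, its image under the symmetric matrix of a suitable index would
    consist of integers below 1, hence vanish, against invertibility. This yields the exponent g up
    to eps; the exponent 2 is a convenient weakening that leaves room for eps. The constant c1
    covers small h. *)
Lemma linear_lower z eps T Q t : 0 < eps <= 1 / 20 -> 1 <= T -> roy_seq z eps T Q t ->
  exists2 c : R, 0 < c & forall u v h : R,
    u \is a Num.int -> v \is a Num.int -> ~ (u = 0 /\ v = 0) ->
    `|u| <= h -> `|v| <= h -> c <= h ^+ 2 * `|v - u * z|.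
Proof.
move=> /andP[e0 e1] T1 rs; have e01 : 0 <= eps <= 1 / 20 by rewrite ltW.
pose Z : R := 1 + `|z|; have Z1 : 1 <= Z by rewrite lerDl.
have /andP[g1 g2] := @golden_bounds R.
pose c1 : R := expR (- (golden + 1 + eps) * t 0) / 4.
pose c2 : R := ((8 * Z) ^+ 2)^-1 / 4.
have c10 : 0 < c1 by rewrite divr_gt0 ?expR_gt0.
have Z8 : 0 < (8 * Z) ^+ 2 by rewrite exprn_gt0 //; lra.
have c20 : 0 < c2 by rewrite divr_gt0 ?invr_gt0.
exists (Num.min c1 c2); first by rewrite lt_min c10.
move=> u v h ui vi uv hu hv.
have h1 : 1 <= h.
  have [u0|u0] := eqVneq u 0.
    have v0 : v != 0 by apply/eqP => v0; apply: uv.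
    exact: le_trans (norm_intr_ge1 vi v0) hv.
  exact: le_trans (norm_intr_ge1 ui u0) hu.
set l := `|_|; have l0 : 0 <= l by rewrite normr_ge0.
pose c := golden + 1 - 2 * eps.
have c0 : 0 < c by rewrite /c; lra.
have key k : 8 * Z * h <= expR (c * t k) ->
    expR (- (golden + 1 + eps) * t k) / 4 <= l.
  move=> hk; rewrite leNgt; apply/negP => lk.
  have [bN dN] := rs_cross e01 T1 rs k.
  have iN := int_vec_cross (rs_int rs k) (rs_int rs k.+1).
  have [s1 s2 _] := symmetric_image bN hu hv (lexx l).
  apply: (symmetric_image_neq0 (rs_disc rs k) uv).
  set N := cross _ _ in bN dN iN s1 s2 *.
  have small : 2 * expR ((golden + 1 + eps) * t k) * l + drift z N * h < 1.
    have p1 : 2 * expR ((golden + 1 + eps) * t k) * l < 1 / 2.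
      move: lk; rewrite mulNr expRN.
      set E := expR _; have E0 : 0 < E by apply: expR_gt0.
      by rewrite -(ltr_pM2r E0) mulrAC mulVf ?gt_eqF //; lra.
    have p2 : drift z N * h <= 1 / 4.
      have h0 : 0 <= h by lra.
      apply: le_trans (ler_wpM2r h0 dN) _.
      rewrite mulNr expRN -/c -/Z.
      set E := expR _; have E0 : 0 < E by apply: expR_gt0.
      rewrite mulrAC ler_pdivrMr //; move: hk; rewrite -/E; lra.
    lra.
  split; apply: int_norm_lt1.
  - by rewrite rpredB // rpredM.
  - exact: le_lt_trans s1 small.
  - by rewrite rpredB // rpredM.
  exact: le_lt_trans s2 small.
have h2 : l <= h ^+ 2 * l by rewrite ler_peMl // exprn_ege1.
have h80 : 0 < 8 * Z * h by rewrite mulr_gt0 ?mulr_gt0 //; lra.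
have lnE : expR (ln (8 * Z * h)) = 8 * Z * h by rewrite lnK.
rewrite ge_min; have [hy|hy] := lerP (ln (8 * Z * h)) (c * t 0).
  apply/orP; left; apply: le_trans h2; apply: key.
  by rewrite -lnE ler_expR.
apply/orP; right.
have [k _ /andP[ky yk]] := rs_locate e1 T1 rs c0 hy.
have lk : expR (- (golden + 1 + eps) * t k.+1) / 4 <= l.
  by apply: key; rewrite -lnE ler_expR.
have hk : expR (c * t k) <= 8 * Z * h by rewrite -lnE ler_expR ltW.
have hk2 : expR (c * t k) ^+ 2 <= (8 * Z) ^+ 2 * h ^+ 2.
  by rewrite -exprMn ler_sqr ?nnegrE ?expR_ge0 // ltW.
(* Up to eps this says (g + 1) t_(k+1) <= 2 (g + 1) t_k, true since g < 2. *)
have E1 : 1 <= expR (c * t k) ^+ 2 * expR (- (golden + 1 + eps) * t k.+1).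
  rewrite expr2 -!expRD -[leLHS]expR0 ler_expR.
  have tk := rs_start rs k; have /andP[_ tk1] := rs_growth rs k.
  have h3 : (golden + 1 + eps) * t k.+1 <= (golden + 1 + eps) * ((golden + eps) * t k).
    by rewrite ler_wpM2l //; lra.
  have gg := @golden_sqr R.
  have h4 : 0 <= (2 * c - (golden + 1 + eps) * (golden + eps)) * t k.
    rewrite mulr_ge0 //; last by lra.
    by rewrite /c; nra.
  lra.
rewrite /c2 -(ler_pM2l Z8) mulrA divff ?gt_eqF // mul1r.
have := ler_pM _ _ hk2 lk; rewrite !exprn_ge0 ?divr_ge0 ?expR_ge0 //.
move=> /(_ isT isT); move: E1; set E := expR _ ^+ 2; set E' := expR _; lra.
Qed.

End RoyConsequences.

(** * Uniform exponents, upper bounds *)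

Section UniformCubic.
Context {R : realType}.
Implicit Types (z eps T : R).

Definition cubic_solution z (y eta : R) : Prop := exists p : nat -> R,
  [/\ int_vec p, bounded_by (expR y) p
    & 0 < `|pair4 p (powers z)| <= expR (- eta * y)].

Definition simul_solution z (y eta : R) : Prop := exists s : nat -> R,
  [/\ int_vec s, s 0%N != 0, `|s 0%N| <= expR y
    & forall i, (0 < i < 4)%N -> `|z ^+ i * s 0%N - s i| <= expR (- eta * y)].

Lemma expR_small (C x : R) : C <= x -> C * expR (- x) < 1.
Proof.
move=> Cx; rewrite expRN ltr_pdivrMr ?expR_gt0 // mul1r.
by apply: lt_le_trans (expR_ge1Dx x); lra.
Qed.

(** Disposes of constant factors, with x of the form e t. *)
Lemma expR_absorb (C x A : R) : C <= x -> C * expR A <= expR (A + x).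
Proof.
move=> Cx; rewrite expRD mulrC ler_pM2l ?expR_gt0 //.
by apply: le_trans (expR_ge1Dx x); lra.
Qed.

Lemma norm_pair4 z X d (a s : nat -> R) : bounded_by X a ->
  (forall i, (0 < i < 4)%N -> `|z ^+ i * s 0%N - s i| <= d) ->
  `|pair4 a s| <= `|s 0%N| * `|pair4 a (powers z)| + 3 * (X * d).
Proof.
move=> ba hs.
have -> : pair4 a s = s 0%N * pair4 a (powers z) - a 1%N * (z ^+ 1 * s 0%N - s 1%N)
  - a 2%N * (z ^+ 2 * s 0%N - s 2%N) - a 3%N * (z ^+ 3 * s 0%N - s 3%N).
  by rewrite /pair4 /powers expr0 expr1; ring.
have -> : `|s 0%N| * `|pair4 a (powers z)| + 3 * (X * d) =
  `|s 0%N| * `|pair4 a (powers z)| + X * d + X * d + X * d by ring.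
apply: ler_normBB; last by apply: ler_normM => //; apply: hs.
apply: ler_normBB; last by apply: ler_normM => //; apply: hs.
by apply: ler_normBB; [rewrite normrM | apply: ler_normM => //; apply: hs].
Qed.

Lemma rs_back z eps T Q t : 0 <= eps <= 1 / 20 -> 1 <= T -> roy_seq z eps T Q t ->
  forall k, (golden - 1 - eps) * t k.+1 <= t k <= (golden - 1 + eps) * t k.+1.
Proof.
move=> /andP[e0 e1] T1 rs k; have /andP[h1 h2] := rs_growth rs k.
have tk := rs_start rs k; have gg := @golden_sqr R.
have /andP[g1 g2] := @golden_bounds R.
set g := golden in gg g1 g2 h1 h2 *.
have a0 : 0 <= g - 1 - eps by lra.
have b0 : 0 <= g - 1 + eps by lra.
apply/andP; split.
  apply: le_trans (ler_wpM2l a0 h2) _.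
  have -> : (g - 1 - eps) * ((g + eps) * t k) =
    (g * g - g - eps - eps * eps) * t k by ring.
  rewrite gg; have : 0 <= eps * eps by rewrite mulr_ge0.
  by nra.
apply: le_trans (ler_wpM2l b0 h1).
have -> : (g - 1 + eps) * ((g - eps) * t k) =
  (g * g - g + eps - eps * eps) * t k by ring.
rewrite gg; have : 0 <= eps * (1 - eps) by rewrite mulr_ge0 //; lra.
by nra.
Qed.

(** With s = t_4 one has t_3 = s/g and t_0 = s/g^4 up to e. As g + 1 = g^2 and 2 g + 1 = g^3, the
    two bounds are 1/g^2 + 1/g = 1 and 1/g^2 + g^2 = 3. *)
Lemma four_arith (g e s t0 t1 t2 t3 : R) : g * g = g + 1 -> 21 / 13 < g < 34 / 21 ->
  0 < e <= 1 / 20 -> 0 < t0 -> 0 < t1 -> 0 < t2 -> 0 < t3 -> 0 < s ->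
  (g - 1 - e) * s <= t3 <= (g - 1 + e) * s ->
  (g - 1 - e) * t3 <= t2 <= (g - 1 + e) * t3 ->
  (g - 1 - e) * t2 <= t1 <= (g - 1 + e) * t2 ->
  (g - 1 - e) * t1 <= t0 <= (g - 1 + e) * t1 ->
  (g + 1 + e) * t0 + t3 <= (1 + 13 * e) * s /\
  (3 - 18 * e) * s <= (g + 1 - 2 * e) * t0 + (2 * g + 1 - e) * t3.
Proof.
move=> gg /andP[g1 g2] /andP[e0 e1] t00 t10 t20 t30 s0.
move=> /andP[a3 b3] /andP[a2 b2] /andP[a1 b1] /andP[a0 b0].
have le1 u v : 0 < u -> v <= (g - 1 + e) * u -> e * v <= e * u.
  by move=> u0 h; rewrite ler_pM2l //; nra.
have e3 := le1 _ _ s0 b3; have e2 := le1 _ _ t30 b2.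
have e1' := le1 _ _ t20 b1; have e0' := le1 _ _ t10 b0.
(* One step back multiplies the coefficient by 1/g = g - 1 and adds at most 1 to the coefficient of
   the error e s. *)
have step u v al c : 0 <= c -> (g - 1 - e) * v <= u <= (g - 1 + e) * v ->
    al * s - c * (e * s) <= v <= al * s + c * (e * s) -> e * v <= e * s ->
    (g - 1) * al * s - (c + 1) * (e * s) <= u <= (g - 1) * al * s + (c + 1) * (e * s).
  move=> c0 /andP[h1 h2] /andP[h3 h4] h5.
  have g10 : 0 <= g - 1 by lra.
  have h6 := ler_wpM2l g10 h3; have h7 := ler_wpM2l g10 h4.
  have h8 : 0 <= c * (e * s) by rewrite !mulr_ge0 // ltW.
  have h9 : (g - 1) * (c * (e * s)) <= c * (e * s) by nra.
  by apply/andP; split; lra.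
have /andP[l3 u3] : (g - 1) * s - 1 * (e * s) <= t3 <= (g - 1) * s + 1 * (e * s).
  by apply/andP; split; lra.
have r2 := step t2 t3 (g - 1) 1 ler01.
have {r2} r2 : (2 - g) * s - 2 * (e * s) <= t2 <= (2 - g) * s + 2 * (e * s).
  have := r2; rewrite a2 b2 l3 u3 e3 => /(_ isT isT isT).
  have -> : (g - 1) * (g - 1) = 2 - g.
    have -> : (g - 1) * (g - 1) = g * g - 2 * g + 1 by ring.
    by rewrite gg; ring.
  by have -> : (1 + 1 : R) = 2 by ring.
have r1 := step t1 t2 (2 - g) 2 (ler0n _ _).
have {r1} r1 : (2 * g - 3) * s - 3 * (e * s) <= t1 <= (2 * g - 3) * s + 3 * (e * s).
  have := r1; rewrite a1 b1 r2 => /(_ isT isT).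
  have -> : (g - 1) * (2 - g) = 2 * g - 3.
    have -> : (g - 1) * (2 - g) = 3 * g - g * g - 2 by ring.
    by rewrite gg; ring.
  have -> : (2 + 1 : R) = 3 by ring.
  by apply; lra.
have r0 := step t0 t1 (2 * g - 3) 3 (ler0n _ _).
have {r0} /andP[l0 u0] : (5 - 3 * g) * s - 4 * (e * s) <= t0
    <= (5 - 3 * g) * s + 4 * (e * s).
  have := r0; rewrite a0 b0 r1 => /(_ isT isT).
  have -> : (g - 1) * (2 * g - 3) = 5 - 3 * g.
    have -> : (g - 1) * (2 * g - 3) = 2 * (g * g) - 5 * g + 3 by ring.
    by rewrite gg; ring.
  have -> : (3 + 1 : R) = 4 by ring.
  by apply; lra.
have es : 0 < e * s by rewrite mulr_gt0.
have G1 : 0 <= g + 1 by lra.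
have G2 : 0 <= 2 * g + 1 by lra.
have E1 : (g + 1) * ((5 - 3 * g) * s) = (2 - g) * s.
  have -> : (g + 1) * ((5 - 3 * g) * s) = (2 * g + 5 - 3 * (g * g)) * s by ring.
  by rewrite gg; ring.
have E2 : (2 * g + 1) * ((g - 1) * s) = (g + 1) * s.
  have -> : (2 * g + 1) * ((g - 1) * s) = (2 * (g * g) - g - 1) * s by ring.
  by rewrite gg; ring.
have F1 : (g + 1) * (e * s) <= 8 / 3 * (e * s) by rewrite ler_pM2r //; lra.
have F2 : (2 * g + 1) * (e * s) <= 13 / 3 * (e * s) by rewrite ler_pM2r //; lra.
split.
  by have := ler_wpM2l G1 u0; lra.
by have := ler_wpM2l G1 l0; have := ler_wpM2l G2 l3; lra.
Qed.

Lemma four_cubics z : (forall eps T, 0 < eps <= 1 / 20 -> exists Q t, roy_seq z eps T Q t) ->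
  forall eps B, 0 < eps <= 1 -> exists2 Y, B < Y & exists a b c d : nat -> R,
  [/\ [/\ int_vec a, int_vec b, int_vec c & int_vec d],
      [/\ bounded_by (expR ((1 + eps) * Y)) a, bounded_by (expR ((1 + eps) * Y)) b,
          bounded_by (expR ((1 + eps) * Y)) c & bounded_by (expR ((1 + eps) * Y)) d],
      [/\ `|pair4 a (powers z)| <= expR (- (3 - eps) * Y),
          `|pair4 b (powers z)| <= expR (- (3 - eps) * Y),
          `|pair4 c (powers z)| <= expR (- (3 - eps) * Y)
        & `|pair4 d (powers z)| <= expR (- (3 - eps) * Y)]
    & det4 a b c d != 0].
Proof.
move=> hroy eps B /andP[eps0 eps1].
pose e : R := eps / 20.
have eE : eps = 20 * e by rewrite /e; field.
have he : 0 < e <= 1 / 20 by rewrite /e; apply/andP; split; lra.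
have he' : 0 <= e <= 1 / 20 by have /andP[/ltW-> ->] := he.
have /andP[e0 e1] := he; clearbody e; rewrite {}eE {eps0 eps1 eps}.
pose C : R := 4 + 2 * (1 + `|z|); have C4 : 4 <= C by rewrite lerDl mulr_ge0 ?addr_ge0.
pose T := Num.max 1 (Num.max (B + 1) (C / e)).
have [Q [t rs]] := hroy e T he.
have T1 : 1 <= T by rewrite le_max lexx.
have TB : B + 1 <= T by rewrite !le_max lexx orbT.
have TC : C / e <= T by rewrite !le_max lexx !orbT.
exists (t 4%N); first by have := rs_start rs 4; lra.
have tp k : 0 < t k by have := rs_start rs k; lra.
have abs k : C <= e * t k.
  by rewrite mulrC -ler_pdivrMr // (le_trans TC) // (rs_start rs).
have et4 : 0 < e * t 4%N by rewrite mulr_gt0.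
have [A1 A2] := four_arith golden_sqr golden_bounds he (tp 0%N) (tp 1%N) (tp 2%N)
  (tp 3%N) (tp 4%N) (rs_back he' T1 rs 3) (rs_back he' T1 rs 2)
  (rs_back he' T1 rs 1) (rs_back he' T1 rs 0).
set N := cross (Q 0%N) (Q 1%N).
have iN : int_vec N := int_vec_cross (rs_int rs 0) (rs_int rs 1).
have [bN dN] := rs_cross he' T1 rs 0.
have g3 : 3 <= 2 * golden + 1 - e by have /andP[g1 _] := @golden_bounds R; lra.
have b3 := rs_bounded rs 3; have b4 := rs_bounded rs 4.
have v3 := rs_eval_le rs 3; have v4 := rs_eval_le rs 4.
have int1 : (1 : R) \is a Num.int by rewrite rpred1.
have int0 : (0 : R) \is a Num.int by rewrite rpred0.
(* The linear forms N1 - N0 T and N2 - N1 T: their values at z are the two entries of [drift], and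
   their determinant is [disc N]. *)
exists (linquad (N 1%N) (- N 0%N) (Q 3%N)), (linquad (N 2%N) (- N 1%N) (Q 3%N)).
exists (linquad 1 0 (Q 4%N)), (linquad 0 1 (Q 4%N)).
have bx i j : bounded_by (expR ((1 + 20 * e) * t 4%N)) (linquad (N i) (- N j) (Q 3%N)).
  have Nj : `|- N j| <= 2 * expR ((golden + 1 + e) * t 0) by rewrite normrN.
  move=> m; apply: le_trans (bounded_linquad (bN i) Nj b3 m) _.
  have -> : 2 * (2 * expR ((golden + 1 + e) * t 0%N) * expR (t 3%N)) =
    4 * expR ((golden + 1 + e) * t 0%N + t 3%N) by rewrite expRD; ring.
  apply: le_trans (expR_absorb _ (le_trans C4 (abs 4%N))) _.
  by rewrite ler_expR; have := tp 4%N; nra.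
have b1 u v : `|u| <= 1 -> `|v| <= 1 ->
    bounded_by (expR ((1 + 20 * e) * t 4%N)) (linquad u v (Q 4%N)).
  move=> hu hv m; apply: le_trans (bounded_linquad hu hv b4 m) _; rewrite mul1r.
  have C2 : 2 <= e * t 4%N by have := abs 4%N; lra.
  apply: le_trans (expR_absorb _ C2) _.
  by rewrite ler_expR; lra.
have ev u v : `|u + v * z| <= drift z N ->
    `|pair4 (linquad u v (Q 3%N)) (powers z)| <= expR (- (3 - 20 * e) * t 4%N).
  move=> huv; rewrite eval_linquad.
  apply: le_trans (ler_normM (le_trans huv dN) v3) _.
  rewrite -[leLHS]mulrA -expRD.
  have C2 : 2 * (1 + `|z|) <= e * t 4%N by have := abs 4%N; rewrite /C; lra.
  apply: le_trans (expR_absorb _ C2) _.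
  by rewrite ler_expR; lra.
have ev1 u v : `|u + v * z| <= 1 + `|z| ->
    `|pair4 (linquad u v (Q 4%N)) (powers z)| <= expR (- (3 - 20 * e) * t 4%N).
  move=> huv; rewrite eval_linquad.
  apply: le_trans (ler_normM huv v4) _.
  have C2 : 1 + `|z| <= e * t 4%N by have := abs 4%N; rewrite /C; have := normr_ge0 z; lra.
  apply: le_trans (expR_absorb _ C2) _.
  by rewrite ler_expR; have := tp 4%N; nra.
split.
- by split; apply: int_linquad; rewrite ?rpredN //; exact: (rs_int rs).
- by split; [apply: bx | apply: bx | apply: b1 | apply: b1]; rewrite ?normr1 ?normr0.
- split; [apply: ev | apply: ev | apply: ev1 | apply: ev1].
  + by rewrite mulNr [_ * z]mulrC drift1.
  + by rewrite mulNr [_ * z]mulrC drift2.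
  + by rewrite mul0r addr0 normr1 lerDl.
  by rewrite mul1r add0r lerDr.
rewrite det4_linquad oppr_eq0.
have -> : N 1%N * - N 1%N - N 2%N * - N 0%N = disc N by rewrite /disc; ring.
by rewrite mul1r mul0r subr0 mulr1 mulf_neq0 ?(rs_disc rs).
Qed.

Lemma norm_det4_uniform z X E H A p a b c :
  bounded_by X a -> bounded_by X b -> bounded_by X c -> bounded_by H p ->
  `|pair4 a (powers z)| <= E -> `|pair4 b (powers z)| <= E ->
  `|pair4 c (powers z)| <= E -> `|pair4 p (powers z)| <= A ->
  `|det4 p a b c| <= 6 * (A * X ^+ 3 + 3 * (E * H * X ^+ 2)).
Proof.
move=> ba bb bc bp ea eb ec ep.
apply: le_trans (norm_det4 bp ba bb bc ep ea eb ec) _.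
by rewrite le_eqVlt; apply/orP; left; apply/eqP; ring.
Qed.

(** A solution p would have zero determinant with any three of the four cubics, so by Cramer's rule
    p = 0. *)
Lemma w_hat3_upper z : (forall eps T, 0 < eps <= 1 / 20 -> exists Q t, roy_seq z eps T Q t) ->
  forall delta B, 0 < delta <= 1 ->
  exists2 y, B < y & ~ cubic_solution z y (3 + delta).
Proof.
move=> hroy delta B /andP[d0 d1].
pose e : R := delta / 24.
have dE : delta = 24 * e by rewrite /e; field.
have e0 : 0 < e by rewrite /e; lra.
have e1 : 24 * e <= 1 by rewrite -dE.
clearbody e; rewrite {}dE {d0 d1 delta}.
have [|Y YB [a [b [c [d [[ia ib ic id] [ba bb bc bd] [ea eb ec ed] det0]]]]]] :=
    four_cubics hroy (eps := e) (Num.max (2 * `|B|) (24 / e)).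
  by apply/andP; split; lra.
have YB1 : 2 * `|B| < Y by apply: le_lt_trans YB; rewrite le_max lexx.
have YB2 : 24 < e * Y.
  by rewrite mulrC -ltr_pdivrMr //; apply: le_lt_trans YB; rewrite le_max lexx orbT.
have Y0 : 0 < Y by have := normr_ge0 B; lra.
(* Slightly below Y, so that replacing a row by p brings the determinant below 1; the 24 e in the
   exponent makes up for the loss, as (3 + 24 e)(1 - 4 e) >= 3 + 4 e. *)
exists ((1 - 4 * e) * Y).
  have : 1 / 2 * Y <= (1 - 4 * e) * Y by rewrite ler_pM2r //; lra.
  by have := ler_norm B; lra.
move=> [p [ip bp /andP[p0 pe]]].
have small p' q r : bounded_by (expR ((1 + e) * Y)) p' ->
    bounded_by (expR ((1 + e) * Y)) q -> bounded_by (expR ((1 + e) * Y)) r ->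
    `|pair4 p' (powers z)| <= expR (- (3 - e) * Y) ->
    `|pair4 q (powers z)| <= expR (- (3 - e) * Y) ->
    `|pair4 r (powers z)| <= expR (- (3 - e) * Y) ->
    int_vec p' -> int_vec q -> int_vec r -> det4 p p' q r = 0.
  move=> b1 b2 b3 e1' e2 e3 i1 i2 i3; apply: int_norm_lt1; first exact: int_det4.
  apply: le_lt_trans (norm_det4_uniform b1 b2 b3 bp e1' e2 e3 pe) _.
  rewrite -!expRM_natl -!expRD.
  have k1 : expR (- (3 + 24 * e) * ((1 - 4 * e) * Y) + 3%:R * ((1 + e) * Y)) <=
     expR (- (e * Y)).
    rewrite ler_expR; have : e * (e * Y) <= 1 / 24 * (e * Y).
      by rewrite ler_pM2r ?mulr_gt0 //; lra.
    by lra.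
  have k2 : expR (- (3 - e) * Y + (1 - 4 * e) * Y + 2%:R * ((1 + e) * Y)) <=
     expR (- (e * Y)).
    by rewrite ler_expR; lra.
  have := expR_small (ltW YB2); lra.
have D1 : det4 p b c d = 0 by apply: small.
have D2 : det4 a p c d = 0.
  have -> : det4 a p c d = - det4 p a c d by rewrite /det4 /minor3; ring.
  by rewrite small ?oppr0.
have D3 : det4 a b p d = 0.
  have -> : det4 a b p d = det4 p a b d by rewrite /det4 /minor3; ring.
  exact: small.
have D4 : det4 a b c p = 0.
  have -> : det4 a b c p = - det4 p a b c by rewrite /det4 /minor3; ring.
  by rewrite small ?oppr0.
have pj j : (j < 4)%N -> p j = 0.
  move=> /(det4_cramer a b c d p); rewrite D1 D2 D3 D4 !mul0r !addr0 => /eqP.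
  by rewrite mulf_eq0 (negPf det0) => /eqP.
by move: p0; rewrite /pair4 !pj // !mul0r !addr0 normr0 ltxx.
Qed.

(** A solution would be orthogonal to all four cubics, which [det4_column] excludes. *)
Lemma lambda_hat3_upper z :
  (forall eps T, 0 < eps <= 1 / 20 -> exists Q t, roy_seq z eps T Q t) ->
  forall delta B, 0 < delta <= 1 ->
  exists2 y, B < y & ~ simul_solution z y (1 / 3 + delta).
Proof.
move=> hroy delta B /andP[d0 d1].
pose e : R := delta / 4.
have dE : delta = 4 * e by rewrite /e; field.
have e0 : 0 < e by rewrite /e; lra.
have e1 : 4 * e <= 1 by rewrite -dE.
clearbody e; rewrite {}dE {d0 d1 delta}.
have [|Y YB [a [b [c [d [[ia ib ic id] [ba bb bc bd] [ea eb ec ed] det0]]]]]] :=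
    four_cubics hroy (eps := e) (Num.max `|B| (4 / e)).
  by apply/andP; split; lra.
have YB1 : `|B| < Y by apply: le_lt_trans YB; rewrite le_max lexx.
have YB2 : 4 < e * Y.
  by rewrite mulrC -ltr_pdivrMr //; apply: le_lt_trans YB; rewrite le_max lexx orbT.
have Y0 : 0 < Y by have := normr_ge0 B; lra.
exists ((3 - 2 * e) * Y).
  have : 1 * Y <= (3 - 2 * e) * Y by rewrite ler_pM2r //; lra.
  by have := ler_norm B; lra.
move=> [s [is_ s0 sy se]].
have small p : int_vec p -> bounded_by (expR ((1 + e) * Y)) p ->
    `|pair4 p (powers z)| <= expR (- (3 - e) * Y) -> pair4 p s = 0.
  move=> ip bp ep; apply: int_norm_lt1; first exact: int_pair4.
  apply: le_lt_trans (norm_pair4 bp se) _.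
  have h := ler_pM (normr_ge0 _) (normr_ge0 _) sy ep.
  rewrite -!expRD in h *.
  have k1 : expR ((3 - 2 * e) * Y + - (3 - e) * Y) <= expR (- (e * Y)).
    by rewrite ler_expR; lra.
  have k2 : expR ((1 + e) * Y + - (1 / 3 + 4 * e) * ((3 - 2 * e) * Y)) <=
     expR (- (e * Y)).
    by rewrite ler_expR; have : e * (e * Y) <= 1 / 4 * (e * Y);
       [rewrite ler_pM2r ?mulr_gt0 //; lra | lra].
  have := expR_small (ltW YB2); lra.
have := det4_column a b c d s; rewrite !small // !mul0r !subr0 addr0 => /eqP.
by rewrite mulf_eq0 (negPf det0) (negPf s0).
Qed.

End UniformCubic.

(** * The exponent [w_3] *)

Section CubicPoly.
Context {R : realType}.
Implicit Types (z eps T : R).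

(** The first three bounds make det4(Q, T Q, p, row of Q') smaller than 1, where Q, Q' have
    logarithmic heights t, t'. F is the exponent of det4(p, row of Q, Q', T Q'), and the last bound
    is the contradiction with [linear_lower]. *)
Lemma w3_arith (g e t t' y : R) : g * g = g + 1 -> 21 / 13 < g < 34 / 21 ->
  0 < e -> 60 * e <= 1 -> 0 < t -> (g - e) * t <= t' <= (g + e) * t ->
  (1 - 4 * e) * t <= y <= (g - 3 * e) * t ->
  let q := 2 * g + 1 in
  let F := y - t + 4 * (e * t) in
  [/\ - (q + 60 * e) * y + (2 * t + t') <= - (e * t),
      - (q - e) * t + (y + t + t') <= - (e * t)
    & - (q - e) * t' + (y + 2 * t) <= - (e * t)] /\
  [/\ - (q + 60 * e) * y + (t + 2 * t') <= F,
      - (q - e) * t + (y + 2 * t') <= F,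
      - (q - e) * t' + (y + t + t') <= F
    & 2 * F + 3 * (e * t) - (q + 60 * e) * y + (q + e) * t <= - (e * t)].
Proof.
move=> gg /andP[g1 g2] e0 e1 t0 /andP[t'1 t'2] /andP[y1 y2] q F.
have et0 : 0 < e * t by rewrite mulr_gt0.
have et1 : 60 * (e * t) <= t by rewrite mulrA ler_piMl // ltW.
have eet : 60 * (e * (e * t)) <= e * t by rewrite mulrA ler_piMl // ltW.
have ey : 14 / 15 * (e * t) <= e * y.
  have := ler_wpM2l (ltW e0) y1; lra.
have gy : (2 * g + 1) * t - 18 * (e * t) <= (2 * g + 1) * y.
  have G : 0 <= 2 * g + 1 by lra.
  have := ler_wpM2l G y1.
  have : (2 * g + 1) * (e * t) <= 9 / 2 * (e * t) by rewrite ler_pM2r //; lra.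
  lra.
have gy' : (2 * g - 1) * t - 9 * (e * t) <= (2 * g - 1) * y.
  have G : 0 <= 2 * g - 1 by lra.
  have := ler_wpM2l G y1.
  have : (2 * g - 1) * (e * t) <= 9 / 4 * (e * t) by rewrite ler_pM2r //; lra.
  lra.
have gt : 8 / 5 * t <= g * t by rewrite ler_pM2r //; lra.
have qt : 3 * (g * t) + 2 * t - 6 * (e * t) <= (2 * g + 1 - e) * t'.
  have G : 0 <= 2 * g + 1 - e by lra.
  have := ler_wpM2l G t'1.
  have -> : (2 * g + 1 - e) * ((g - e) * t) =
    (2 * (g * g) + g) * t - (3 * g + 1) * (e * t) + e * (e * t) by ring.
  rewrite gg.
  have : (3 * g + 1) * (e * t) <= 6 * (e * t) by rewrite ler_pM2r //; lra.
  have : 0 <= e * (e * t) by rewrite mulr_ge0 // ltW.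
  lra.
rewrite /F /q; split; split; lra.
Qed.

Lemma rs_rows z eps T Q t (u v : R) : roy_seq z eps T Q t -> forall k,
  `|u| <= 1 -> `|v| <= 1 ->
  bounded_by (2 * expR (t k)) (linquad u v (Q k)) /\
  `|pair4 (linquad u v (Q k)) (powers z)|
    <= (1 + `|z|) * expR (- (2 * golden + 1 - eps) * t k).
Proof.
move=> rs k hu hv; split.
  by have := bounded_linquad hu hv (rs_bounded rs k); rewrite mul1r.
rewrite eval_linquad; apply: ler_normM (rs_eval_le rs k).
by apply: ler_normDD => //; rewrite -[leRHS]mul1r; apply: ler_normM.
Qed.

(** A value that small kills the determinants of p with Q, T Q and a row of the next Q'. By Cramer's
    rule rho p = (c_0 + c_1 T) Q, with rho the resultant up to sign. Then |c_0 + c_1 z| = |rho p(z)|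
    / |Q(z)| is too small for [linear_lower]. *)
Lemma w3_upper z : (forall eps T, 0 < eps <= 1 / 20 -> exists Q t, roy_seq z eps T Q t) ->
  forall delta, 0 < delta <= 1 ->
  exists B, forall y, B < y -> ~ cubic_solution z y (2 * golden + 1 + delta).
Proof.
move=> hroy delta /andP[d0 d1].
(* The constant c depends on the sequence used, and T below has to absorb K / c; so c is obtained
   first, from an auxiliary sequence. *)
have h20 : 0 < (1 / 20 : R) <= 1 / 20 by apply/andP; split; lra.
have [Q0 [s0 rs0]] := hroy (1 / 20) 1 h20.
have [c c0 hc] := linear_lower h20 (lexx 1) rs0.
pose e : R := delta / 60.
have dE : delta = 60 * e by rewrite /e; field.
have e0 : 0 < e by rewrite /e; lra.
have e1 : 60 * e <= 1 by rewrite -dE.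
clearbody e; rewrite {}dE {d0 d1 delta Q0 s0 rs0 h20}.
pose Z : R := 1 + `|z|; have Z1 : 1 <= Z by rewrite lerDl.
pose K : R := (120 * Z) ^+ 2 * (8 * Z).
pose T := Num.max 1 (Num.max (120 * Z / e) (K / c / e)).
have he : 0 < e <= 1 / 20 by apply/andP; split; lra.
have he' : 0 <= e <= 1 / 20 by apply/andP; split; lra.
have e20 : e <= 1 / 20 by lra.
have [Q [t rs]] := hroy e T he.
have T1 : 1 <= T by rewrite le_max lexx.
have tp k : 0 < t k by have := rs_start rs k; lra.
have absZ k : 120 * Z <= e * t k.
  rewrite [leRHS]mulrC -ler_pdivrMr //; apply: le_trans (rs_start rs k).
  by rewrite !le_max lexx orbT.
have absK k : K / c <= e * t k.
  rewrite [leRHS]mulrC -ler_pdivrMr //; apply: le_trans (rs_start rs k).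
  by rewrite !le_max lexx !orbT.
have gb := @golden_bounds R; have gg := @golden_sqr R; have /andP[g1 g2] := gb.
pose q : R := 2 * golden + 1.
exists ((golden - 3 * e) * t 0%N) => y yB [p [ip bp /andP[p0 pe]]].
have cg : 0 < golden - 3 * e by lra.
have [k _ /andP[ky yk]] := rs_locate e20 T1 rs cg yB.
have ylow : (1 - 4 * e) * t k.+1 <= y.
  have /andP[h _] := rs_back he' T1 rs k.
  apply: le_trans (ltW ky); apply: le_trans (ler_wpM2l (ltW cg) h).
  rewrite mulrA ler_pM2r //.
  have -> : (golden - 3 * e) * (golden - 1 - e) =
    golden * golden - golden - e * (4 * golden - 3) + 3 * (e * e) by ring.
  rewrite gg; have : e * (4 * golden - 3) <= e * 4 by rewrite ler_pM2l //; lra.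
  have : 0 < e * e by rewrite mulr_gt0.
  lra.
have yrange : (1 - 4 * e) * t k.+1 <= y <= (golden - 3 * e) * t k.+1 by rewrite ylow.
have [[a1 a2 a3] [a4 a5 a6 a7]] :=
  w3_arith gg gb e0 e1 (tp k.+1) (rs_growth rs k.+1) yrange.
rewrite -/q in a1 a2 a3 a4 a5 a6 a7 pe.
have n0 : `|0 : R| <= 1 by rewrite normr0.
have n1 : `|1 : R| <= 1 by rewrite normr1.
have [bq1 vq1] := rs_rows rs k.+1 n1 n0; have [bq2 vq2] := rs_rows rs k.+1 n0 n1.
have [br1 vr1] := rs_rows rs k.+2 n1 n0; have [br2 vr2] := rs_rows rs k.+2 n0 n1.
have int1 : (1 : R) \is a Num.int by rewrite rpred1.
have int0 : (0 : R) \is a Num.int by rewrite rpred0.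
have iq1 := int_linquad int1 int0 (rs_int rs k.+1).
have iq2 := int_linquad int0 int1 (rs_int rs k.+1).
have ir1 := int_linquad int1 int0 (rs_int rs k.+2).
have ir2 := int_linquad int0 int1 (rs_int rs k.+2).
have absZ1 := absZ k.+1; have absK1 := absK k.+1.
have rho0 := rs_disc rs k.+1.
have [bN dN] := rs_cross he' T1 rs k.+1.
have /andP[Qlow _] := rs_eval rs k.+1; rewrite -/q -/Z in Qlow dN *.
rewrite -/q -/Z in vq1 vq2 vr1 vr2.
set tt := t k.+1 in absZ1 absK1 a1 a2 a3 a4 a5 a6 a7 bq1 vq1 bq2 vq2 bN dN Qlow.
set t' := t k.+2 in a1 a2 a3 a4 a5 a6 a7 br1 vr1 br2 vr2.
set q1 := linquad 1 0 (Q k.+1) in bq1 vq1 iq1.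
set q2 := linquad 0 1 (Q k.+1) in bq2 vq2 iq2.
set r1 := linquad 1 0 (Q k.+2) in br1 vr1 ir1.
set r2 := linquad 0 1 (Q k.+2) in br2 vr2 ir2.
have rhoE : det4 q1 q2 r1 r2 = - disc (cross (Q k.+1) (Q k.+2)).
  by rewrite det4_linquad; ring.
have Z0 : 0 <= Z by exact: le_trans ler01 Z1.
have E (A B C D : R) G : A + (B + C + D) <= G ->
    expR A * (expR B * expR C * expR D) <= expR G.
  by rewrite -!expRD ler_expR.
have small r : int_vec r -> bounded_by (2 * expR t') r ->
    `|pair4 r (powers z)| <= Z * expR (- (q - e) * t') -> det4 q1 q2 p r = 0.
  move=> ir br vr; apply: int_norm_lt1; first exact: int_det4.
  apply: le_lt_trans (norm_det4 bq1 bq2 bp br vq1 vq2 pe vr) _.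
  have k1 := E (- (q - e) * tt) tt y t' (- (e * tt)).
  have k2 := E (- (q + 60 * e) * y) tt tt t' (- (e * tt)).
  have k3 := E (- (q - e) * t') tt tt y (- (e * tt)).
  have {}k1 := ler_wpM2l Z0 (k1 ltac:(clear -a2; lra)).
  have {}k2 := k2 ltac:(clear -a1; lra).
  have {}k3 := ler_wpM2l Z0 (k3 ltac:(clear -a3; lra)).
  have := expR_small absZ1.
  have : expR (- (e * tt)) <= Z * expR (- (e * tt)) by rewrite ler_peMl ?expR_ge0.
  clear -k1 k2 k3; lra.
have D3 := small _ ir2 br2 vr2.
have D4 : det4 q1 q2 r1 p = 0.
  have -> : det4 q1 q2 r1 p = - det4 q1 q2 p r1 by rewrite /det4 /minor3; ring.
  by rewrite small ?oppr0.
pose F := y - tt + 4 * (e * tt).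
pose h := 120 * Z * expR F.
have hbound m : int_vec m -> bounded_by (2 * expR tt) m ->
    `|pair4 m (powers z)| <= Z * expR (- (q - e) * tt) -> `|det4 p m r1 r2| <= h.
  move=> im bm vm.
  apply: le_trans (norm_det4 bp bm br1 br2 pe vm vr1 vr2) _.
  have k1 := E (- (q + 60 * e) * y) tt t' t' F.
  have k2 := E (- (q - e) * tt) y t' t' F.
  have k3 := E (- (q - e) * t') y tt t' F.
  have {}k1 : _ <= _ := k1 ltac:(clear -a4; rewrite /F; lra).
  have {}k2 := ler_wpM2l Z0 (k2 ltac:(clear -a5; rewrite /F; lra)).
  have {}k3 := ler_wpM2l Z0 (k3 ltac:(clear -a6; rewrite /F; lra)).
  have : expR F <= Z * expR F by rewrite ler_peMl ?expR_ge0.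
  rewrite /h; clear -k1 k2 k3; lra.
pose c0' := det4 p q2 r1 r2; pose c1 := det4 q1 p r1 r2.
have c1E : c1 = - det4 p q1 r1 r2 by rewrite /c1 /det4 /minor3; ring.
have hc0 : `|c0'| <= h by apply: hbound.
have hc1 : `|- c1| <= h by rewrite c1E opprK; apply: hbound.
have ic0 : c0' \is a Num.int by apply: int_det4.
have ic1 : - c1 \is a Num.int by rewrite rpredN; apply: int_det4.
have cram j : (j < 4)%N -> det4 q1 q2 r1 r2 * p j = c0' * q1 j + c1 * q2 j.
  move=> /(det4_cramer q1 q2 r1 r2 p) ->; rewrite D3 D4 !mul0r !addr0 //.
have cne : ~ (- c1 = 0 /\ c0' = 0).
  move=> [/eqP]; rewrite oppr_eq0 => /eqP z1 z0.
  have pj j : (j < 4)%N -> p j = 0.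
    move=> /cram; rewrite z0 z1 !mul0r addr0 rhoE => /eqP.
    by rewrite mulf_eq0 oppr_eq0 (negPf rho0) => /eqP.
  by move: p0; rewrite /pair4 !pj // !mul0r !addr0 normr0 ltxx.
(* The sign of c1 is due to [linear_lower] being stated for v - u z. *)
have := hc _ _ _ ic1 ic0 cne hc1 hc0.
set l := `|_|; have l0 : 0 <= l by rewrite normr_ge0.
have lE : l * `|eval2 z (Q k.+1)| =
    `|disc (cross (Q k.+1) (Q k.+2))| * `|pair4 p (powers z)|.
  have eq : (c0' - - c1 * z) * eval2 z (Q k.+1) =
      - disc (cross (Q k.+1) (Q k.+2)) * pair4 p (powers z).
    rewrite -rhoE /pair4 !mulrDr !mulrA !cram // /q1 /q2 /linquad /powers /eval2.
    by ring.
  by rewrite /l -normrM eq normrM normrN.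
have rhole : `|disc (cross (Q k.+1) (Q k.+2))| <= 8 * Z * expR (3 * (e * tt)).
  apply: le_trans (norm_disc z bN) _.
  have E0 := expR_ge0 ((golden + 1 + e) * tt).
  have := ler_wpM2l E0 dN.
  have -> : expR (3 * (e * tt)) = expR ((golden + 1 + e) * tt)
    * expR (- (golden + 1 - 2 * e) * tt) by rewrite -expRD; congr expR; ring.
  clear; lra.
have lle : l <= 8 * Z * expR (3 * (e * tt) - (q + 60 * e) * y + (q + e) * tt).
  have E0 := expR_gt0 (- (q + e) * tt).
  rewrite -(ler_pM2r E0); apply: le_trans (ler_wpM2l l0 Qlow) _.
  rewrite lE; apply: le_trans (ler_pM (normr_ge0 _) (normr_ge0 _) rhole pe) _.
  rewrite -!mulrA -!expRD.
  have -> : 3 * (e * tt) - (q + 60 * e) * y + (q + e) * tt + - (q + e) * tt =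
    3 * (e * tt) + - (q + 60 * e) * y by ring.
  exact: lexx.
have h0 : 0 <= h ^+ 2 by rewrite exprn_ge0 ?mulr_ge0 ?expR_ge0.
move=> /le_trans/(_ (ler_wpM2l h0 lle)).
have hK W : h ^+ 2 * (8 * Z * expR W) = K * expR (2 * F + W).
  have -> : 2 * F + W = F + F + W by ring.
  by rewrite 2!expRD /h /K; ring.
rewrite hK !addrA.
have K0 : 0 <= K by rewrite mulr_ge0 ?exprn_ge0 ?mulr_ge0.
have : K * expR (2 * F + 3 * (e * tt) - (q + 60 * e) * y + (q + e) * tt) <=
    K * expR (- (e * tt)) by rewrite ler_wpM2l // ler_expR.
move=> /[swap] /le_trans/[apply].
have := expR_small absK1; rewrite mulrAC ltr_pdivrMr // mul1r.
by rewrite ltNge => /negP.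
Qed.

End CubicPoly.

(** * The exponent [lambda_3] *)

Section CubicSimul.
Context {R : realType}.
Implicit Types (z eps T r : R).

(** r is 1/sqrt 5, and g + 2 = 2 g^2 - g = g sqrt 5. *)
Lemma golden_r r : r * (2 * golden - 1) = 1 ->
  [/\ r * (golden + 2) = golden, 0 < r & r <= 1 / 2].
Proof.
move=> hr; have /andP[g1 g2] := @golden_bounds R; have gg := @golden_sqr R.
set g := golden in hr g1 g2 gg *.
have r0 : 0 < r.
  have h : 0 < 2 * g - 1 by lra.
  by rewrite -(pmulr_lgt0 r h) hr.
split=> //; last by nra.
have -> : r * (g + 2) = r * (2 * (g * g) - g) by rewrite gg; ring.
have -> : r * (2 * (g * g) - g) = g * (r * (2 * g - 1)) by ring.
by rewrite hr mulr1.
Qed.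

(** The cross product of three vectors in dimension 4. *)
Definition cofactors (a b c : nat -> R) : nat -> R := fun i =>
  match i with
  | 0%N => minor3 a b c 1 2 3
  | 1%N => - minor3 a b c 0 2 3
  | 2%N => minor3 a b c 0 1 3
  | _ => - minor3 a b c 0 1 2
  end.

Lemma pair4_cofactors p a b c : pair4 p (cofactors a b c) = det4 p a b c.
Proof. by rewrite /pair4 /det4 /=; ring. Qed.

(** The cofactors have size exp((g + 2) t) and error exp(-g t) up to eps, and g / (g + 2) = r. *)
Lemma lambda3_lower z r : r * (2 * golden - 1) = 1 ->
  (forall eps T, 0 < eps <= 1 / 20 -> exists Q t, roy_seq z eps T Q t) ->
  forall delta B, 0 < delta <= 1 / 20 ->
  exists2 y, B < y & simul_solution z y (r - delta).
Proof.
move=> hr hroy delta B /andP[d0 d1].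
have [hr1 r0 r1] := golden_r hr.
pose e : R := delta / 2.
have dE : delta = 2 * e by rewrite /e; field.
have e0 : 0 < e by rewrite /e; lra.
have e1 : 2 * e <= 1 / 20 by rewrite -dE.
clearbody e; rewrite {}dE {d0 d1 delta}.
pose Z : R := 1 + `|z|; have Z1 : 1 <= Z by rewrite lerDl.
have Z0 : 0 <= Z by exact: le_trans ler01 Z1.
pose C : R := 72 * Z ^+ 4.
have C72 : 72 <= C by rewrite ler_peMr // exprn_ege1.
pose T := Num.max 1 (Num.max `|B| (C / e)).
have he : 0 < e <= 1 / 20 by apply/andP; split; lra.
have he' : 0 <= e <= 1 / 20 by apply/andP; split; lra.
have [Q [t rs]] := hroy e T he.
have T1 : 1 <= T by rewrite le_max lexx.
have TB : `|B| <= T by rewrite !le_max lexx orbT.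
have TC : C / e <= T by rewrite !le_max lexx !orbT.
have t0 : 1 <= t 0%N by have := rs_start rs 0; lra.
have absC : C <= e * t 0%N.
  by rewrite mulrC -ler_pdivrMr // (le_trans TC) // (rs_start rs).
have /andP[g1 g2] := @golden_bounds R; have gg := @golden_sqr R.
have /andP[tl tu] := rs_growth rs 0.
have tB : `|B| <= t 0%N by apply: le_trans TB (rs_start rs 0).
have n0 : `|0 : R| <= 1 by rewrite normr0.
have n1 : `|1 : R| <= 1 by rewrite normr1.
have [bq1 vq1] := rs_rows rs 0 n1 n0; have [bq2 vq2] := rs_rows rs 0 n0 n1.
have [br1 vr1] := rs_rows rs 1 n1 n0.
have int1 : (1 : R) \is a Num.int by rewrite rpred1.
have int0 : (0 : R) \is a Num.int by rewrite rpred0.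
have iq1 := int_linquad int1 int0 (rs_int rs 0).
have iq2 := int_linquad int0 int1 (rs_int rs 0).
have ir1 := int_linquad int1 int0 (rs_int rs 1).
have rho0 := rs_disc rs 0.
rewrite -/Z in vq1 vq2 vr1.
set tt := t 0%N in t0 absC tl tu tB bq1 bq2 vq1 vq2.
set t' := t 1%N in tl tu br1 vr1.
set q1 := linquad 1 0 (Q 0%N) in bq1 vq1 iq1.
set q2 := linquad 0 1 (Q 0%N) in bq2 vq2 iq2.
set r1' := linquad 1 0 (Q 1%N) in br1 vr1 ir1.
pose s := cofactors q1 q2 r1'.
have is_ : int_vec s.
  by case=> [|[|[|i]]]; rewrite /s /cofactors ?rpredN; apply: int_minor3.
have et0 : 0 < e * tt by rewrite mulr_gt0 //; lra.
have bs : `|s 0%N| <= expR ((2 + golden + 2 * e) * tt).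
  apply: le_trans (norm_minor3 _ _ _ bq1 bq2 br1) _.
  have -> : 6 * (2 * expR tt * (2 * expR tt) * (2 * expR t')) =
    48 * expR (tt + tt + t') by rewrite !expRD; ring.
  have C48 : 48 <= e * tt by apply: le_trans absC; apply: le_trans C72; rewrite ler_nat.
  apply: le_trans (expR_absorb _ C48) _; rewrite ler_expR; clear -tu; lra.
have err i : (0 < i < 4)%N ->
    `|z ^+ i * s 0%N - s i| <= expR (- (golden - 3 * e) * tt).
  move=> /andP[i0 i4].
  (* D is the cubic z^i - T^i. It vanishes at z, so the error, which is its determinant with the
     three rows, loses its largest potential term. *)
  pose D (j : nat) : R := if j == 0%N then z ^+ i else if j == i then - 1 else 0.
  have -> : z ^+ i * s 0%N - s i = pair4 D s.
    by case: i i0 i4 @D => [|[|[|[|]]]] // _ _ D; rewrite /pair4 /D /=; ring.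
  have bD : bounded_by (Z ^+ 3) D.
    have Z31 : 1 <= Z ^+ 3 by rewrite exprn_ege1.
    move=> j; rewrite /D; case: eqP => _.
      rewrite normrX; apply: (@le_trans _ _ (Z ^+ i)).
        by rewrite lerXn2r ?nnegrE // lerDr.
      by apply: ler_weXn2l.
    by case: eqP => _; rewrite ?normrN ?normr1 ?normr0 // (le_trans ler01).
  have vD : `|pair4 D (powers z)| <= 0.
    suff -> : pair4 D (powers z) = 0 by rewrite normr0.
    by case: i i0 i4 @D bD => [|[|[|[|]]]] // _ _ D _; rewrite /pair4 /D /powers /=; ring.
  rewrite pair4_cofactors.
  apply: le_trans (norm_det4 bD bq1 bq2 br1 vD vq1 vq2 vr1) _.
  have E (A a b G : R) : A + (a + b) <= G ->
      Z ^+ 4 * (expR A * (expR a * expR b)) <= Z ^+ 4 * expR G.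
    by move=> h; rewrite ler_wpM2l ?exprn_ge0 // -!expRD ler_expR.
  have k1 := E (- (2 * golden + 1 - e) * tt) tt t' (- (golden - 2 * e) * tt)
    ltac:(clear -tu; lra).
  have qt : (golden - 2 * e) * tt + 2 * tt <= (2 * golden + 1 - e) * t'.
    have h := ler_wpM2l (_ : 0 <= 2 * golden + 1 - e) tl.
    apply: le_trans (h _); last by lra.
    rewrite -mulrDl mulrA ler_pM2r; last by lra.
    have -> : (2 * golden + 1 - e) * (golden - e) =
      2 * (golden * golden) + golden - e * (3 * golden + 1) + e * e by ring.
    by rewrite gg; clear -e0 e1 g1 g2; nra.
  have k2 := E (- (2 * golden + 1 - e) * t') tt tt (- (golden - 2 * e) * tt)
    ltac:(clear -qt; lra).
  have k3 := expR_absorb (- (golden - 2 * e) * tt) absC.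
  have k4 : expR (- (golden - 2 * e) * tt + e * tt) = expR (- (golden - 3 * e) * tt).
    by congr expR; ring.
  rewrite k4 /C in k3; apply: le_trans k3; clear -k1 k2; lra.
exists ((2 + golden + 2 * e) * tt).
  have : 1 * tt <= (2 + golden + 2 * e) * tt by rewrite ler_pM2r; lra.
  have : 0 < tt by lra.
  have := ler_norm B; clear -tB g1 e0; nra.
have err' i : (0 < i < 4)%N ->
   `|z ^+ i * s 0%N - s i| <= expR (- (r - 2 * e) * ((2 + golden + 2 * e) * tt)).
  move=> hi; apply: le_trans (err i hi) _; rewrite ler_expR.
  have -> : - (r - 2 * e) * ((2 + golden + 2 * e) * tt) =
    - (r * (golden + 2)) * tt - 2 * r * (e * tt)
    + 2 * (2 + golden + 2 * e) * (e * tt) by ring.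
  rewrite hr1; have : r * (e * tt) <= 1 / 2 * (e * tt) by rewrite ler_pM2r.
  have : 3 * (e * tt) <= (2 + golden + 2 * e) * (e * tt) by rewrite ler_pM2r //; lra.
  clear -et0; lra.
(* If s_0 = 0, the small errors make s vanish altogether, but its pairing with T Q_1 is a nonzero
   resultant up to sign. *)
exists s; split=> //; apply/eqP => s00.
have sj i : (0 < i < 4)%N -> s i = 0.
  move=> hi; apply: int_norm_lt1 => //; have := err i hi.
  rewrite s00 mulr0 sub0r normrN => /le_lt_trans; apply.
  by rewrite -[ltRHS]expR0 ltr_expR mulNr oppr_lt0 mulr_gt0 //; lra.
have : pair4 (linquad 0 1 (Q 1%N)) s = 0.
  by rewrite /pair4 s00 !sj // !mulr0 !addr0.
rewrite pair4_cofactors => /eqP; apply/negP.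
have -> : det4 (linquad 0 1 (Q 1%N)) q1 q2 r1' = - det4 q1 q2 r1' (linquad 0 1 (Q 1%N)).
  by rewrite /det4 /minor3; ring.
rewrite det4_linquad opprK; rewrite !mul0r !subr0 !mul1r.
exact: rho0.
Qed.

(** [t], [t1], [t2] are three successive logarithmic heights in descending order. G and M are the
    exponents of the two terms bounding the image of the pair under the symmetric matrix; 2 G + M <
    0 contradicts [linear_lower]. The 12 e in the range of y makes M negative. *)
Lemma lambda3_arith (g r e t t1 t2 y : R) : g * g = g + 1 -> 21 / 13 < g < 34 / 21 ->
  r * (2 * g - 1) = 1 -> r * (g + 2) = g -> 0 < r <= 1 / 2 ->
  0 < e -> 20 * e <= 1 / 20 -> 0 < t -> 0 < t1 -> 0 < t2 ->
  (g - 1 - e) * t <= t1 <= (g - 1 + e) * t ->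
  (g - 1 - e) * t1 <= t2 <= (g - 1 + e) * t1 ->
  (g + 2 - 12 * e) * t1 < y <= (g + 2 - 12 * e) * t ->
  let q := 2 * g + 1 in let eta := r + 20 * e in
  let G := (g + 7 * e) * t - eta * y in
  let M := y - (g + 2) * t + 11 * (e * t) in
  [/\ - (q - e) * t + y <= - (e * t), t - eta * y <= - (e * t)
    & t1 - eta * y <= - (q - e) * t1 + y] /\
  [/\ (g + 1 + e) * t2 + (t1 - eta * y) <= G,
      - (g + 1 - 2 * e) * t2 + (- (q - e) * t1 + y) <= M,
      M <= - (e * t) & 2 * G + M <= - (e * t)].
Proof.
move=> gg /andP[g1 g2] r1 r2 /andP[r0 r3] e0 e1 t0 t10 t20.
move=> /andP[a1 b1] /andP[a2 b2] /andP[y1 y2] q eta G M.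
have et0 : 0 < e * t by rewrite mulr_gt0.
have et1 : 400 * (e * t) <= t by rewrite mulrA ler_piMl //; lra.
have eet : 400 * (e * (e * t)) <= e * t by rewrite mulrA ler_piMl //; lra.
have eet0 : 0 < e * (e * t) by rewrite mulr_gt0.
have t1t : t1 <= t by apply: le_trans b1 _; rewrite ler_piMl ?ltW //; lra.
have t2t : t2 <= t1 by apply: le_trans b2 _; rewrite ler_piMl ?ltW //; lra.
have et1t : e * t1 <= e * t by rewrite ler_pM2l.
have et2t : e * t2 <= e * t by rewrite ler_pM2l // (le_trans t2t).
have g10 : 0 <= g - 1 by lra.
have U2 : t2 <= (2 - g) * t + 2 * (e * t).
  have := ler_wpM2l g10 b1.
  have -> : (g - 1) * ((g - 1 + e) * t) = (g * g - 2 * g + 1) * t + (g - 1) * (e * t).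
    by ring.
  have : (g - 1) * (e * t) <= 1 * (e * t) by rewrite ler_pM2r //; lra.
  rewrite gg; clear -b2 et1t; lra.
have L2 : (2 - g) * t - 2 * (e * t) <= t2.
  have := ler_wpM2l g10 a1.
  have -> : (g - 1) * ((g - 1 - e) * t) = (g * g - 2 * g + 1) * t - (g - 1) * (e * t).
    by ring.
  have : (g - 1) * (e * t) <= 1 * (e * t) by rewrite ler_pM2r //; lra.
  rewrite gg; clear -a2 et1t; lra.
have Y : (2 * g - 1) * t - 12 * (e * t) <= y.
  have P0 : 0 <= g + 2 - 12 * e by lra.
  have := ler_wpM2l P0 a1.
  have -> : (g + 2 - 12 * e) * ((g - 1 - e) * t) =
    (g * g + g - 2) * t - (13 * g - 10) * (e * t) + 12 * (e * (e * t)) by ring.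
  have : (13 * g - 10) * (e * t) <= 12 * (e * t) by rewrite ler_pM2r //; lra.
  rewrite gg; clear -y1 eet0; lra.
have gt : 21 / 13 * t <= g * t by rewrite ler_pM2r //; lra.
have gt' : g * t <= 34 / 21 * t by rewrite ler_pM2r //; lra.
have y2t : 2 * t <= y by clear -Y gt et1 et0; lra.
have ey : 2 * (e * t) <= e * y by rewrite mulrCA ler_pM2l.
have ry : t - 6 * (e * t) <= r * y.
  have := ler_wpM2l (ltW r0) Y.
  have -> : r * ((2 * g - 1) * t - 12 * (e * t)) =
    r * (2 * g - 1) * t - 12 * (r * (e * t)) by ring.
  have : r * (e * t) <= 1 / 2 * (e * t) by rewrite ler_pM2r.
  rewrite r1; clear; lra.
have etay : t + 34 * (e * t) <= eta * y by rewrite /eta; clear -ry ey; lra.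
have qt1 : (2 * g + 1) * t1 <= (g + 1) * t + 5 * (e * t).
  have P0 : 0 <= 2 * g + 1 by lra.
  have := ler_wpM2l P0 b1.
  have -> : (2 * g + 1) * ((g - 1 + e) * t) =
    (2 * (g * g) - g - 1) * t + (2 * g + 1) * (e * t) by ring.
  have : (2 * g + 1) * (e * t) <= 5 * (e * t) by rewrite ler_pM2r //; lra.
  rewrite gg; clear; lra.
have qt1' : (g + 1) * t - 5 * (e * t) <= (2 * g + 1 - e) * t1.
  have P0 : 0 <= 2 * g + 1 by lra.
  have := ler_wpM2l P0 a1.
  have -> : (2 * g + 1) * ((g - 1 - e) * t) =
    (2 * (g * g) - g - 1) * t - (2 * g + 1) * (e * t) by ring.
  have : (2 * g + 1) * (e * t) <= 13 / 3 * (e * t) by rewrite ler_pM2r //; lra.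
  have : e * t1 <= 2 / 3 * (e * t).
    rewrite mulrCA ler_pM2l //; apply: le_trans b1 _; rewrite ler_pM2r //; lra.
  rewrite gg; clear; lra.
have pt2 : (g + 1 + e) * t2 <= t + 6 * (e * t).
  have P0 : 0 <= g + 1 by lra.
  have := ler_wpM2l P0 U2.
  have -> : (g + 1) * ((2 - g) * t + 2 * (e * t)) =
    (g + 2 - g * g) * t + 2 * ((g + 1) * (e * t)) by ring.
  have : (g + 1) * (e * t) <= 8 / 3 * (e * t) by rewrite ler_pM2r //; lra.
  have : e * t2 <= 1 / 2 * (e * t).
    rewrite mulrCA ler_pM2l //; clear -U2 gt et1 et0; lra.
  rewrite gg; clear -et0; lra.
have pt2' : t - 6 * (e * t) <= (g + 1 - 2 * e) * t2.
  have P0 : 0 <= g + 1 - 2 * e by lra.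
  have := ler_wpM2l P0 L2.
  have -> : (g + 1 - 2 * e) * ((2 - g) * t - 2 * (e * t)) =
    (g + 2 - g * g) * t - 6 * (e * t) + 4 * (e * (e * t)) by ring.
  rewrite gg; clear -eet0; lra.
have rY : (1 - 2 * r) * y <= (2 - g) * t.
  have P0 : 0 <= 1 - 2 * r by lra.
  have y3 : y <= (g + 2) * t by clear -y2 et0; lra.
  have := ler_wpM2l P0 y3.
  have -> : (1 - 2 * r) * ((g + 2) * t) = (g + 2) * t - 2 * (r * (g + 2)) * t by ring.
  rewrite r2; clear; lra.
split; split.
- by rewrite /q; clear -y2 gt et1 et0; lra.
- by clear -etay et0; lra.
- by rewrite /q; clear -etay b1 qt1 Y et0 t10 e0; nra.
- by rewrite /G; clear -pt2 b1; lra.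
- by rewrite /M /q; clear -pt2' qt1'; lra.
- by rewrite /M; clear -y2; lra.
by rewrite /G /M /eta; clear -rY ey et0; lra.
Qed.

(** For y near (g + 2) t the pair (u, v) has size exp t and error exp(-t) up to eps, no better than
    Dirichlet's theorem offers. The symmetric matrix has size exp t and drift exp(-t), so it shrinks
    the pair to size about 1 with error about 1; the excess in the exponent then decides. *)
Lemma lambda3_upper z r : r * (2 * golden - 1) = 1 ->
  (forall eps T, 0 < eps <= 1 / 20 -> exists Q t, roy_seq z eps T Q t) ->
  forall delta, 0 < delta <= 1 / 20 ->
  exists B, forall y, B < y -> ~ simul_solution z y (r + delta).
Proof.
move=> hr hroy delta /andP[d0 d1].
have [hr1 r0 r1] := golden_r hr.
have h20 : 0 < (1 / 20 : R) <= 1 / 20 by apply/andP; split; lra.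
have [Q0 [s0 rs0]] := hroy (1 / 20) 1 h20.
have [c c0 hc] := linear_lower h20 (lexx 1) rs0.
pose e : R := delta / 20.
have dE : delta = 20 * e by rewrite /e; field.
have e0 : 0 < e by rewrite /e; lra.
have e1 : 20 * e <= 1 / 20 by rewrite -dE.
clearbody e; rewrite {}dE {d0 d1 delta Q0 s0 rs0 h20}.
pose Z : R := 1 + `|z|; have Z1 : 1 <= Z by rewrite lerDl.
have Z0 : 0 <= Z by exact: le_trans ler01 Z1.
pose K : R := (24 * Z) ^+ 2 * (28 * Z ^+ 2).
pose T := Num.max 1 (Num.max (28 * Z ^+ 2 / e) (K / c / e)).
have he : 0 < e <= 1 / 20 by apply/andP; split; lra.
have he' : 0 <= e <= 1 / 20 by apply/andP; split; lra.
have e20 : e <= 1 / 20 by lra.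
have [Q [t rs]] := hroy e T he.
have T1 : 1 <= T by rewrite le_max lexx.
have tp k : 0 < t k by have := rs_start rs k; lra.
have absZ k : 28 * Z ^+ 2 <= e * t k.
  rewrite [leRHS]mulrC -ler_pdivrMr //; apply: le_trans (rs_start rs k).
  by rewrite !le_max lexx orbT.
have absK k : K / c <= e * t k.
  rewrite [leRHS]mulrC -ler_pdivrMr //; apply: le_trans (rs_start rs k).
  by rewrite !le_max lexx !orbT.
have gb := @golden_bounds R; have gg := @golden_sqr R; have /andP[g1 g2] := gb.
pose q : R := 2 * golden + 1.
exists ((golden + 2 - 12 * e) * t 1%N) => y yB [s [is_ s0 sy se]].
have cg : 0 < golden + 2 - 12 * e by lra.
(* The search starts at index 1 because the symmetric matrix involves one index below the located
   one. *)
have [[//|m] _ /andP[ky yk]] := rs_locate e20 T1 rs cg yB.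
have yrange : (golden + 2 - 12 * e) * t m.+1 < y <= (golden + 2 - 12 * e) * t m.+2.
  by rewrite ky.
have r01 : 0 < r <= 1 / 2 by rewrite r0.
have [[a1 a2 a3] [a4 a5 a6 a7]] := lambda3_arith gg gb hr hr1 r01 e0 e1
  (tp m.+2) (tp m.+1) (tp m) (rs_back he' T1 rs m.+1) (rs_back he' T1 rs m) yrange.
pose eta := r + 20 * e.
rewrite -/q -/eta in a1 a2 a3 a4 a5 a6 a7 se.
have n0 : `|0 : R| <= 1 by rewrite normr0.
have n1 : `|1 : R| <= 1 by rewrite normr1.
have [bq1 vq1] := rs_rows rs m.+1 n1 n0; have [bq2 vq2] := rs_rows rs m.+1 n0 n1.
have [br1 vr1] := rs_rows rs m.+2 n1 n0; have [br2 vr2] := rs_rows rs m.+2 n0 n1.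
have int1 : (1 : R) \is a Num.int by rewrite rpred1.
have int0 : (0 : R) \is a Num.int by rewrite rpred0.
have iq1 := int_linquad int1 int0 (rs_int rs m.+1).
have iq2 := int_linquad int0 int1 (rs_int rs m.+1).
have ir1 := int_linquad int1 int0 (rs_int rs m.+2).
have ir2 := int_linquad int0 int1 (rs_int rs m.+2).
have absZ1 := absZ m.+2; have absK1 := absK m.+2.
have [bN dN] := rs_cross he' T1 rs m.
have iN := int_vec_cross (rs_int rs m) (rs_int rs m.+1).
have bQ := rs_bounded rs m.+1.
rewrite -/q -/Z in vq1 vq2 vr1 vr2 dN.
set N := cross (Q m) (Q m.+1) in bN dN iN.
set tt := t m.+2 in absZ1 absK1 a1 a2 a3 a4 a5 a6 a7 br1 vr1 br2 vr2.
set t1 := t m.+1 in a1 a2 a3 a4 a5 a6 a7 bq1 vq1 bq2 vq2 bQ.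
set t2 := t m in a4 a5 bN dN.
pose G := (golden + 7 * e) * tt - eta * y.
pose M := y - (golden + 2) * tt + 11 * (e * tt).
pose A := - (q - e) * t1 + y.
rewrite -/G -/M -/A in a3 a4 a5 a6 a7.
pose d := expR (- eta * y).
have perp u v : `|u| <= 1 -> `|v| <= 1 -> u \is a Num.int -> v \is a Num.int ->
    pair4 (linquad u v (Q m.+2)) s = 0.
  move=> hu hv iu iv; apply: int_norm_lt1.
    by apply: int_pair4 is_; apply: int_linquad (rs_int rs _).
  have [b vv] := rs_rows rs m.+2 hu hv.
  apply: le_lt_trans (norm_pair4 b se) _; rewrite -/q -/Z -/tt -/d in vv *.
  have h := ler_pM (normr_ge0 _) (normr_ge0 _) sy vv.
  have k1 : expR y * expR (- (q - e) * tt) <= expR (- (e * tt)).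
    by rewrite -expRD ler_expR; clear -a1; lra.
  have k2 : expR tt * d <= expR (- (e * tt)).
    by rewrite -expRD ler_expR; clear -a2; lra.
  have k3 := ler_wpM2l Z0 k1.
  have k4 : (Z + 6) * expR (- (e * tt)) <= 28 * Z ^+ 2 * expR (- (e * tt)).
    by rewrite ler_wpM2r ?expR_ge0 //; clear -Z1; nra.
  have k5 := expR_small absZ1.
  clear -h k2 k3 k4 k5; lra.
pose u := pair4 (linquad 1 0 (Q m.+1)) s; pose v := pair4 (linquad 0 1 (Q m.+1)) s.
have uv0 : ~ (u = 0 /\ v = 0).
  move=> [u0 v0]; apply: (perp_linquad_neq0 (rs_disc rs m.+1) s0).
  by split=> //; apply: perp.
have hA b : bounded_by (2 * expR t1) b ->
    `|pair4 b (powers z)| <= Z * expR (- (q - e) * t1) ->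
    `|pair4 b s| <= (Z + 6) * expR A.
  move=> bb vb; apply: le_trans (norm_pair4 bb se) _; rewrite -/d.
  have h := ler_pM (normr_ge0 _) (normr_ge0 _) sy vb.
  have k1 : expR y * expR (- (q - e) * t1) = expR A.
    by rewrite -expRD /A; congr expR; ring.
  have k2 : expR t1 * d <= expR A by rewrite -expRD ler_expR mulNr.
  have k3 : expR y * (Z * expR (- (q - e) * t1)) = Z * expR A by rewrite mulrCA k1.
  clear -h k2 k3; lra.
have hu : `|u| <= (Z + 6) * expR A by apply: hA.
have hv : `|v| <= (Z + 6) * expR A by apply: hA.
have iu : u \is a Num.int by apply: int_pair4.
have iv : v \is a Num.int by apply: int_pair4.
have hl : `|v - u * z| <= 6 * Z * expR (t1 - eta * y).
  (* The cubic (T - z) Q vanishes at z, so only the approximation errors of s contribute. *)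
  have -> : v - u * z = pair4 (linquad (- z) 1 (Q m.+1)) s.
    by rewrite [RHS]pair4_linquad /u /v; ring.
  have z1 : `|- z| <= Z by rewrite normrN lerDr.
  have z2 : `|1 : R| <= Z by rewrite normr1.
  apply: le_trans (norm_pair4 (bounded_linquad z1 z2 bQ) se) _.
  rewrite eval_linquad mul1r addNr mul0r normr0 mulr0 add0r.
  have -> : expR (t1 - eta * y) = expR t1 * expR (- eta * y).
    by rewrite -expRD; congr expR; ring.
  by rewrite le_eqVlt; apply/orP; left; apply/eqP; ring.
have [s1 s2 s3] := symmetric_image bN hu hv hl.
have := symmetric_image_neq0 (rs_disc rs m) uv0; rewrite -/N.
set u' := N 1%N * u - N 0%N * v in s1 s3 *.
set v' := N 2%N * u - N 1%N * v in s2 s3 *.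
move=> uv0'.
have iu' : u' \is a Num.int by rewrite rpredB // rpredM.
have iv' : v' \is a Num.int by rewrite rpredB // rpredM.
have dh : drift z N * ((Z + 6) * expR A) <= 14 * Z ^+ 2 * expR M.
  have P0 : 0 <= (Z + 6) * expR A by rewrite mulr_ge0 ?expR_ge0 ?addr_ge0.
  apply: le_trans (ler_wpM2r P0 dN) _.
  have -> : 2 * Z * expR (- (golden + 1 - 2 * e) * t2) * ((Z + 6) * expR A) =
    2 * Z * (Z + 6) * (expR (- (golden + 1 - 2 * e) * t2) * expR A) by ring.
  rewrite -expRD; apply: ler_pM; rewrite ?expR_ge0 ?mulr_ge0 ?addr_ge0 ?ler_expR //.
  by clear -Z1; nra.
have dh1 : 14 * Z ^+ 2 * expR M < 1 / 2.
  have k1 : expR M <= expR (- (e * tt)) by rewrite ler_expR.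
  have Z20 : 0 <= Z ^+ 2 by rewrite exprn_ge0.
  have := ler_wpM2l Z20 k1; have := expR_small absZ1; clear; lra.
have Xl : 2 * expR ((golden + 1 + e) * t2) * (6 * Z * expR (t1 - eta * y)) <=
    12 * Z * expR G.
  have -> : 2 * expR ((golden + 1 + e) * t2) * (6 * Z * expR (t1 - eta * y)) =
    12 * Z * (expR ((golden + 1 + e) * t2) * expR (t1 - eta * y)) by ring.
  by rewrite -expRD ler_wpM2l ?mulr_ge0 // ler_expR.
(* Otherwise both image coordinates are integers below 1, hence 0. So the term in exp G dominates
   and doubling it bounds the image. *)
have G12 : 1 / 2 <= 12 * Z * expR G.
  rewrite leNgt; apply/negP => hG; apply: uv0'; split; apply: int_norm_lt1 => //.
    by apply: le_lt_trans s1 _; clear -Xl dh dh1 hG; lra.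
  by apply: le_lt_trans s2 _; clear -Xl dh dh1 hG; lra.
have hu' : `|u'| <= 24 * Z * expR G.
  by apply: le_trans s1 _; clear -Xl dh dh1 G12; lra.
have hv' : `|v'| <= 24 * Z * expR G.
  by apply: le_trans s2 _; clear -Xl dh dh1 G12; lra.
have := hc _ _ _ iu' iv' uv0' hu' hv'.
have l'' : `|v' - u' * z| <= 28 * Z ^+ 2 * expR M.
  by apply: le_trans s3 _; clear -dh; lra.
have h0 : 0 <= (24 * Z * expR G) ^+ 2 by rewrite exprn_ge0 ?mulr_ge0 ?expR_ge0.
move=> /le_trans/(_ (ler_wpM2l h0 l'')).
have -> : (24 * Z * expR G) ^+ 2 * (28 * Z ^+ 2 * expR M) = K * expR (2 * G + M).
  have -> : 2 * G + M = G + G + M by ring.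
  by rewrite (expRD (G + G)) (expRD G) /K; ring.
have K0 : 0 <= K by rewrite !mulr_ge0 ?exprn_ge0 ?mulr_ge0.
have : K * expR (2 * G + M) <= K * expR (- (e * tt)) by rewrite ler_wpM2l // ler_expR.
move=> /[swap] /le_trans/[apply].
have := expR_small absK1; rewrite mulrAC ltr_pdivrMr // mul1r.
by rewrite ltNge => /negP.
Qed.

End CubicSimul.

(** * Dirichlet bounds and the exponents *)

(** [dirichlet_cubic] has (N + 1)^4 vectors for N^4 + 1 boxes. *)
Lemma expn4_succ_lt (N : nat) : (0 < N)%N -> ((N ^ 4).+1 < N.+1 ^ 4)%N.
Proof. by rewrite !expnS !expn0; nia. Qed.

Section Dirichlet.
Context {R : realType}.
Implicit Types (z y : R).

Lemma pigeonhole_fin (A B : finType) (f : A -> B) : (#|B| < #|A|)%N ->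
  exists x y : A, x != y /\ f x = f y.
Proof.
move=> BA; have /injectivePn[x [y xy fxy]] : ~~ injectiveb f.
  by apply/negP => /injectiveP/leq_card; rewrite leqNgt BA.
by exists x, y.
Qed.

Lemma trunc_eq_dist (a b : R) : 0 <= a -> 0 <= b -> Num.trunc a = Num.trunc b ->
  `|a - b| <= 1.
Proof.
move=> /truncn_itv/andP[a1 a2] /truncn_itv/andP[b1 b2] e.
rewrite e -natr1 in a1 a2; rewrite -natr1 in b2.
by rewrite ler_norml; apply/andP; split; lra.
Qed.

Lemma dirichlet_cubic z (N : nat) : (0 < N)%N -> exists p : nat -> R,
  [/\ int_vec p, bounded_by N%:R p, exists2 j, (j < 4)%N & p j != 0
    & `|pair4 p (powers z)| * N%:R ^+ 3 <= 8 * (1 + `|z|) ^+ 3].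
Proof.
move=> N0; pose Z : R := 1 + `|z|; have Z1 : 1 <= Z by rewrite lerDl.
pose S : R := 4 * Z ^+ 3.
have S0 : 0 < S by rewrite mulr_gt0 // exprn_gt0 // (lt_le_trans ltr01).
pose n : R := N%:R; have n0 : 0 < n by rewrite ltr0n.
pose vec (c : {ffun 'I_4 -> 'I_N.+1}) (j : nat) : R :=
  if (j < 4)%N then (c (inord j) : nat)%:R else 0.
have vec_bd c : bounded_by n (vec c).
  move=> j; rewrite /vec; case: ifP => _; last by rewrite normr0 ltW.
  by rewrite ger0_norm // ler_nat -ltnS ltn_ord.
have val_bd c : `|pair4 (vec c) (powers z)| <= n * S.
  have zj j : (j < 4)%N -> `|powers z j| <= Z ^+ 3.
    move=> j4; rewrite /powers normrX; apply: (@le_trans _ _ (Z ^+ j)).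
      by rewrite lerXn2r ?nnegrE ?lerDr // (le_trans ler01).
    by apply: ler_weXn2l.
  have -> : n * S = n * Z ^+ 3 + n * Z ^+ 3 + n * Z ^+ 3 + n * Z ^+ 3.
    by rewrite /S; ring.
  by do 3?apply: ler_normDD; apply: ler_normM (vec_bd c _) (zj _ _).
(* The values are rescaled from [-n S, n S] to [0, n^4], so that truncation numbers the boxes. *)
pose x c := (pair4 (vec c) (powers z) + n * S) * (n ^+ 3 / (2 * S)).
have k0 : 0 < n ^+ 3 / (2 * S) by apply: divr_gt0; [apply: exprn_gt0 | apply: mulr_gt0].
have x0 c : 0 <= x c.
  rewrite mulr_ge0 ?(ltW k0) //; have := val_bd c; rewrite ler_norml.
  by move=> /andP[h _]; lra.
have x1 c : (Num.trunc (x c) < (N ^ 4).+1)%N.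
  rewrite ltnS truncn_le_nat -natr1 natrX -/n.
  have : x c <= n ^+ 4; last by lra.
  have -> : n ^+ 4 = (n * S + n * S) * (n ^+ 3 / (2 * S)).
    by field; rewrite gt_eqF.
  rewrite ler_pM2r //; have := val_bd c; rewrite ler_norml.
  by move=> /andP[_ h]; lra.
have [|c [d [cd fcd]]] := @pigeonhole_fin _ _ (fun c => Ordinal (x1 c)).
  by rewrite card_ord card_ffun !card_ord expn4_succ_lt.
have {fcd} fcd : Num.trunc (x c) = Num.trunc (x d) by case: fcd.
exists (fun j => vec c j - vec d j); split.
- by move=> j; rewrite rpredB // /vec; case: ifP; rewrite ?rpred_nat ?rpred0.
- move=> j; rewrite /vec; case: ifP => _; last by rewrite subr0 normr0.
  have hc := ltn_ord (c (inord j)); have hd := ltn_ord (d (inord j)).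
  rewrite ler_norml; apply/andP; split.
    have : (d (inord j) : nat)%:R <= n by rewrite ler_nat -ltnS.
    have : 0 <= (c (inord j) : nat)%:R :> R by [].
    by rewrite -/n; lra.
  have : (c (inord j) : nat)%:R <= n by rewrite ler_nat -ltnS.
  have : 0 <= (d (inord j) : nat)%:R :> R by [].
  by rewrite -/n; lra.
- apply: contrapT => h; move/eqP: cd; apply; apply/ffunP => j.
  apply/eqP; apply: contrapT => /negP cj; apply: h; exists j => //.
  rewrite /vec ltn_ord inord_val subr_eq0 eqr_nat.
  by apply: contra cj => /eqP/ord_inj ->.
have := trunc_eq_dist (x0 c) (x0 d) fcd.
have -> : x c - x d =
    pair4 (fun j => vec c j - vec d j) (powers z) * (n ^+ 3 / (2 * S)).
  by rewrite /x /pair4; ring.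
have S20 : 0 < 2 * S by apply: mulr_gt0.
rewrite normrM (gtr0_norm k0) mulrA (ler_pdivrMr _ _ S20) mul1r => h.
by apply: le_trans h _; rewrite /S /Z; lra.
Qed.

Lemma dirichlet_simul z (N : nat) : (0 < N)%N -> exists s : nat -> R,
  [/\ int_vec s, s 0%N != 0, `|s 0%N| <= N%:R ^+ 3
    & forall i, (0 < i < 4)%N -> `|z ^+ i * s 0%N - s i| * N%:R <= 1].
Proof.
case: N => // n _; set N : R := n.+1%:R.
have N0 : 0 < N by rewrite ltr0n.
pose fr (v : R) : R := v - (Num.floor v)%:~R.
have fr0 v : 0 <= fr v by rewrite subr_ge0 floor_le.
have fr1 v : fr v < 1.
  by have := floorD1_gt v; rewrite rmorphD /= /fr; lra.
pose f (x : 'I_(n.+1 ^ 3).+1) : {ffun 'I_3 -> 'I_n.+1} :=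
  [ffun j : 'I_3 => inord (Num.trunc (fr (z ^+ j.+1 * (x : nat)%:R) * N))].
have [|c [d [cd fcd]]] := @pigeonhole_fin _ _ f.
  by rewrite card_ffun !card_ord.
pose s (i : nat) : R := if i is 0%N then (c : nat)%:R - (d : nat)%:R
  else (Num.floor (z ^+ i * (c : nat)%:R) - Num.floor (z ^+ i * (d : nat)%:R))%:~R.
exists s; split.
- by case=> [|i]; rewrite /s ?intr_int // rpredB ?rpred_nat.
- by rewrite /s subr_eq0 eqr_nat; apply: contra cd => /eqP/ord_inj ->.
- have bd (k : 'I_(n.+1 ^ 3).+1) : (k : nat)%:R <= N ^+ 3.
    by rewrite /N -natrX ler_nat -ltnS ltn_ord.
  have := bd c; have := bd d; rewrite /s.
  have : 0 <= (c : nat)%:R :> R by []; have : 0 <= (d : nat)%:R :> R by [].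
  by move=> *; rewrite ler_norml; apply/andP; split; lra.
move=> [//|i] /= i4; have i3 : (i < 3)%N by rewrite -ltnS.
pose g (x : 'I_(n.+1 ^ 3).+1) : R := fr (z ^+ i.+1 * (x : nat)%:R) * N.
have lt x : (Num.trunc (g x) < n.+1)%N.
  rewrite truncn_lt_nat ?mulr_ge0 ?(ltW N0) // -/N.
  by rewrite -[ltRHS]mul1r ltr_pM2r.
have e : Num.trunc (g c) = Num.trunc (g d).
  move/ffunP/(_ (Ordinal i3)): fcd; rewrite !ffunE /= => /(congr1 val).
  by rewrite /= !inordK //; [apply: lt d | apply: lt c].
have NN := ltW N0.
have := trunc_eq_dist (mulr_ge0 (fr0 _) NN) (mulr_ge0 (fr0 _) NN) e.
rewrite -mulrBl normrM (gtr0_norm N0); apply: le_trans.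
rewrite le_eqVlt; apply/orP; left; apply/eqP; congr (`|_| * _).
by rewrite /s /fr rmorphB /=; ring.
Qed.

Lemma trunc_expR y : 0 <= y ->
  let N := Num.trunc (expR y) in
  [/\ (0 < N)%N, N%:R <= expR y & expR y <= 2 * N%:R].
Proof.
move=> y0 N; have /andP[h1 h2] := truncn_itv (expR_ge0 y); rewrite -/N in h1 h2.
have E1 : 1 <= expR y by rewrite -[leLHS]expR0 ler_expR.
have N0 : (0 < N)%N.
  by rewrite lt0n; apply/eqP => N0; move: h2; rewrite N0; lra.
split=> //; have : 1 <= N%:R :> R by rewrite ler1n.
by move: h2; rewrite -natr1; lra.
Qed.

Lemma w_hat3_lower z :
  (forall p, int_vec p -> (exists2 j, (j < 4)%N & p j != 0) ->
    pair4 p (powers z) != 0) ->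
  forall delta, 0 < delta -> exists B, forall y, B < y ->
    cubic_solution z y (3 - delta).
Proof.
(* The outer 8 is the cube of the loss in exp y <= 2 N. *)
move=> htr delta d0; pose C : R := 8 * (8 * (1 + `|z|) ^+ 3).
have C0 : 0 <= C by rewrite !mulr_ge0 // exprn_ge0 // addr_ge0.
exists (C / delta) => y; rewrite ltr_pdivrMr // => yC.
have y0 : 0 <= y by rewrite -(pmulr_lge0 y d0); lra.
have [N0 N1 N2] := trunc_expR y0; set N := Num.trunc _ in N0 N1 N2.
have [p [ip bp pj hp]] := dirichlet_cubic z N0.
exists p; split=> //; first by move=> j; apply: le_trans (bp j) N1.
rewrite normr_gt0 htr //=.
have yC' : C <= y * delta by rewrite ltW.
have := expR_absorb (- (3 * y)) yC'.
have -> : - (3 * y) + y * delta = - (3 - delta) * y by ring.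
apply: le_trans; rewrite expRN ler_pdivlMr ?expR_gt0 //.
rewrite -[3]/(3%:R) expRM_natl.
have h : expR y ^+ 3 <= (2 * N%:R) ^+ 3.
  by rewrite lerXn2r ?nnegrE ?expR_ge0 ?mulr_ge0.
apply: le_trans (ler_wpM2l (normr_ge0 _) h) _.
by rewrite exprMn /C; clear -hp; lra.
Qed.

Lemma lambda_hat3_lower z delta : 0 < delta -> exists B, forall y, B < y ->
  simul_solution z y (1 / 3 - delta).
Proof.
move=> d0; exists (2 / delta) => y; rewrite ltr_pdivrMr // => yC.
have y0 : 0 < y by rewrite -(pmulr_lgt0 y d0); lra.
have y3 : 0 <= y / 3 by lra.
have [N0 N1 N2] := trunc_expR y3; set N := Num.trunc _ in N0 N1 N2.
have [s [is_ s0 sN se]] := dirichlet_simul z N0.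
exists s; split=> //.
  apply: le_trans sN _; apply: (@le_trans _ _ (expR (y / 3) ^+ 3)).
    by rewrite lerXn2r ?nnegrE ?expR_ge0.
  by rewrite -expRM_natl ler_expR; lra.
move=> i hi; have := expR_absorb (- (y / 3)) (ltW yC).
have -> : - (y / 3) + y * delta = - (1 / 3 - delta) * y by ring.
apply: le_trans; rewrite expRN ler_pdivlMr ?expR_gt0 //.
apply: le_trans (ler_wpM2l (normr_ge0 _) N2) _.
by have := se i hi; clear; lra.
Qed.

End Dirichlet.

(** * From the systems of the definitions to integer vectors, and the suprema *)

Section Exponents.
Context {R : realType}.
Implicit Types (z eta X y : R) (a : nat -> R).

(** [Num.floor] only recovers the integer behind an integer-valued real. *)
Definition vpoly (n : nat) a : {poly int} := \poly_(i < n.+1) Num.floor (a i).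

Lemma vpoly_eval n a z : int_vec a ->
  (map_poly intr (vpoly n a)).[z] = \sum_(i < n.+1) a i * z ^+ i.
Proof.
move=> ia; rewrite (@horner_coef_wide _ n.+1); last first.
  by apply: leq_trans (size_poly _ _) (size_poly _ _).
apply: eq_bigr => i _; rewrite coef_map coef_poly ltn_ord /=.
by rewrite floorK.
Qed.

Lemma vpoly_height n a X : int_vec a -> bounded_by X a -> (height (vpoly n a))%:R <= X.
Proof.
move=> ia ba; have X0 := bounded_ge0 ba.
rewrite -truncn_ge_nat //; apply/bigmax_leqP => j _.
rewrite truncn_ge_nat // /vpoly coef_poly; case: ifP => _; last by [].
have := ba j; rewrite -{1}(floorK (ia j)) -intr_norm -abszE.
by [].
Qed.

Lemma poly_system_of_vec n z eta X a : int_vec a -> bounded_by X a ->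
  0 < `|\sum_(i < n.+1) a i * z ^+ i| <= X `^ (- eta) -> poly_system n z eta X.
Proof.
move=> ia ba h; exists (vpoly n a); split; first exact: size_poly.
  exact: vpoly_height.
by rewrite vpoly_eval.
Qed.

Lemma vec_of_poly_system n z eta X : poly_system n z eta X -> exists a,
  [/\ int_vec a, bounded_by X a
    & 0 < `|\sum_(i < n.+1) a i * z ^+ i| <= X `^ (- eta)].
Proof.
move=> [P [sP hP eP]]; exists (fun i => (P`_i)%:~R); split.
- by move=> i; rewrite intr_int.
- move=> i; have [iP|iP] := ltnP i (size P); last first.
    by rewrite nth_default // normr0 (le_trans _ hP).
  apply: le_trans hP; rewrite -intr_norm -abszE -[X in X <= _]/((absz P`_i)%:R).
  by rewrite ler_nat (leq_bigmax (Ordinal iP)).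
move: eP; rewrite (@horner_coef_wide _ n.+1) ?(leq_trans (size_poly _ _)) //.
by under eq_bigr do rewrite coef_map /=.
Qed.

Lemma sum3_eval2 z a : \sum_(i < 3) a i * z ^+ i = eval2 z a.
Proof. by rewrite !big_ord_recr big_ord0 /= /eval2; ring. Qed.

Lemma sum4_pair4 z a : \sum_(i < 4) a i * z ^+ i = pair4 a (powers z).
Proof. by rewrite !big_ord_recr big_ord0 /= /pair4 /powers; ring. Qed.

Lemma transcendental_sum z n a : transcendental z -> int_vec a ->
  (exists2 j, (j < n.+1)%N & a j != 0) -> \sum_(i < n.+1) a i * z ^+ i != 0.
Proof.
move=> htr ia [j jn aj]; rewrite -vpoly_eval //; apply/eqP => e0; apply: htr.
have p0 : vpoly n a != 0.
  apply/eqP => p0; move: aj; rewrite -(floorK (ia j)) intr_eq0 => /eqP; apply.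
  have := congr1 (fun p : {poly int} => p`_j) p0.
  by rewrite /vpoly coef_poly jn coef0.
exists (map_poly intr (vpoly n a)).
  by rewrite map_poly_eq0_id0 ?intr_eq0 ?lead_coef_eq0.
rewrite -map_poly_comp /root.
have -> : map_poly (ratr \o intr) (vpoly n a) = map_poly intr (vpoly n a) :> {poly R}.
  by apply: eq_map_poly => k /=; rewrite ratr_int.
by rewrite e0.
Qed.

Lemma expR_powR y eta : expR y `^ (- eta) = expR (- eta * y).
Proof. by rewrite -expRM mulrC. Qed.

Lemma cubic_solutionP z eta y :
  poly_system 3 z eta (expR y) <-> cubic_solution z y eta.
Proof.
split.
  move=> /vec_of_poly_system[a [ia ba]]; rewrite sum4_pair4 expR_powR => h.
  by exists a.
move=> [a [ia ba h]]; apply: (poly_system_of_vec ia ba).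
by rewrite sum4_pair4 expR_powR.
Qed.

Lemma simul_solutionP z eta y :
  simul_system 3 z eta (expR y) <-> simul_solution z y eta.
Proof.
split.
  move=> [x [v [/andP[x0 x1] h]]].
  exists (fun i => if i is j.+1 then (v (inord j))%:~R else x%:~R); split.
  - by case=> [|i]; rewrite intr_int.
  - by rewrite -normr_gt0.
  - by [].
  move=> [//|i] /= i3; rewrite -expR_powR; apply: le_trans h.
  have := @le_bigmax_cond _ _ _ 0 (inord i : 'I_3) xpredT
    (fun i : 'I_3 => `|z ^+ i.+1 * x%:~R - (v i)%:~R|) isT.
  by rewrite inordK.
move=> [s [is_ s0 sX se]].
exists (Num.floor (s 0%N)), (fun i : 'I_3 => Num.floor (s i.+1)).
rewrite floorK // normr_gt0 s0 sX; split=> //.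
apply: bigmax_le => [|i _]; first exact: powR_ge0.
rewrite floorK // expR_powR; apply: se.
by rewrite /= ltnS ltn_ord.
Qed.

Lemma ereal_sup_eq (A : R -> Prop) (c : R) :
  (forall eta eta', eta' <= eta -> A eta -> A eta') ->
  (forall delta, 0 < delta <= 1 / 20 -> A (c - delta)) ->
  (forall delta, 0 < delta <= 1 / 20 -> ~ A (c + delta)) ->
  ereal_sup [set eta%:E | eta in [set eta | A eta]]%classic = c%:E.
Proof.
move=> mono lo up; apply/eqP; rewrite eq_le; apply/andP; split.
  apply: ge_ereal_sup => _ [eta /= Aeta <-]; rewrite lee_fin leNgt; apply/negP => ce.
  pose d := Num.min (eta - c) (1 / 20).
  have d1 : d <= eta - c by rewrite ge_min lexx.
  have d2 : d <= 1 / 20 by rewrite ge_min lexx orbT.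
  have d0 : 0 < d by rewrite lt_min; apply/andP; split; lra.
  by apply: (up d); [rewrite d0 | apply: mono Aeta; lra].
set S := ereal_sup _.
have ub d : 0 < d <= 1 / 20 -> ((c - d)%:E <= S)%E.
  by move=> hd; apply: ereal_sup_ubound; exists (c - d) => //=; apply: lo.
(* Rules out that the supremum is -oo. *)
have : ((c - 1 / 20)%:E <= S)%E by apply: ub; apply/andP; split; lra.
case: S ub => [s| |] //= ub _; last by rewrite leey.
rewrite lee_fin leNgt; apply/negP => sc.
pose d := Num.min ((c - s) / 2) (1 / 20).
have d1 : d <= (c - s) / 2 by rewrite ge_min lexx.
have d2 : d <= 1 / 20 by rewrite ge_min lexx orbT.
have d0 : 0 < d by rewrite lt_min; apply/andP; split; lra.
by have := ub d; rewrite d0 d2 lee_fin => /(_ isT); lra.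
Qed.

Lemma poly_system_mono n z X eta eta' : 1 <= X -> eta' <= eta ->
  poly_system n z eta X -> poly_system n z eta' X.
Proof.
move=> X1 ee [P [sP hP /andP[P0 eP]]]; exists P; split=> //; rewrite P0 /=.
by apply: le_trans eP _; rewrite ler_powR // lerN2.
Qed.

Lemma simul_system_mono n z X eta eta' : 1 <= X -> eta' <= eta ->
  simul_system n z eta X -> simul_system n z eta' X.
Proof.
move=> X1 ee [x [v [hx hv]]]; exists x, v; split=> //.
by apply: le_trans hv _; rewrite ler_powR // lerN2.
Qed.

Lemma poly_system_degree m n z eta X : (m <= n)%N ->
  poly_system m z eta X -> poly_system n z eta X.
Proof.
move=> mn [P [sP hP eP]]; exists P; split=> //.
by apply: leq_trans sP _; rewrite ltnS.
Qed.

Lemma lt_expR_abs (B y : R) : `|B| < y -> B < expR y.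
Proof. by have := expR_ge1Dx y; have := ler_norm B; lra. Qed.

Section Systems.
Context (S : R -> R -> Prop)
  (Smono : forall X eta eta', 1 <= X -> eta' <= eta -> S eta X -> S eta' X).

Lemma ereal_sup_arbitrary (c : R) :
  (forall delta B, 0 < delta <= 1 / 20 -> exists2 y, B < y & S (c - delta) (expR y)) ->
  (forall delta, 0 < delta <= 1 / 20 ->
    exists B, forall y, B < y -> ~ S (c + delta) (expR y)) ->
  ereal_sup [set eta%:E | eta in [set eta | arbitrarily_large (S eta)]]%classic = c%:E.
Proof.
move=> lo up; apply: ereal_sup_eq => [eta eta' ee h B|delta hd B|delta hd h].
- have [X XB SX] := h (Num.max B 1); exists X.
    by apply: le_lt_trans XB; rewrite le_max lexx.
  by apply: Smono SX => //; apply/ltW/(le_lt_trans _ XB); rewrite le_max lexx orbT.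
- have [y yB Sy] := lo delta `|B| hd; exists (expR y) => //.
  exact: lt_expR_abs.
have [B hB] := up delta hd; have [X XB SX] := h (expR B).
have X0 : 0 < X by apply: lt_trans XB; apply: expR_gt0.
apply: (hB (ln X)); last by rewrite lnK.
by rewrite -ltr_expR lnK.
Qed.

Lemma ereal_sup_sufficient (c : R) :
  (forall delta, 0 < delta <= 1 / 20 ->
    exists B, forall y, B < y -> S (c - delta) (expR y)) ->
  (forall delta B, 0 < delta <= 1 / 20 ->
    exists2 y, B < y & ~ S (c + delta) (expR y)) ->
  ereal_sup [set eta%:E | eta in [set eta | sufficiently_large (S eta)]]%classic = c%:E.
Proof.
move=> lo up; apply: ereal_sup_eq => [eta eta' ee [B h]|delta hd|delta hd [B h]].
- exists (Num.max B 1) => X XB.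
  have X1 : 1 <= X by apply/ltW/(le_lt_trans _ XB); rewrite le_max lexx orbT.
  by apply: Smono X1 ee (h _ _); apply: le_lt_trans XB; rewrite le_max lexx.
- have [B hB] := lo delta hd; exists (expR B) => X XB.
  have X0 : 0 < X by apply: lt_trans XB; apply: expR_gt0.
  have -> : X = expR (ln X) by rewrite lnK.
  by apply: hB; rewrite -ltr_expR lnK.
have [y yB nS] := up delta `|B| hd; apply: nS; apply: h.
exact: lt_expR_abs.
Qed.

End Systems.

Lemma transcendental_nonzero3 z : transcendental z -> transcendental2 z.
Proof.
move=> htr a ia nza; rewrite -sum3_eval2; apply: transcendental_sum => //.
apply: contrapT => h; apply: nza.
have aj j : (j < 3)%N -> a j = 0.
  by move=> j3; apply/eqP; apply: contrapT => /negP aj; apply: h; exists j.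
by split; apply: aj.
Qed.

Lemma uniform2_of_w_hat z (c eta : R) : w_hat 2 z = c%:E -> eta < c -> uniform2 z eta.
Proof.
move=> hc ec; have : (eta%:E < w_hat 2 z)%E by rewrite hc lte_fin.
move=> /ereal_sup_gt[_ [eta1 /= [B hB] <-]]; rewrite lte_fin => ee.
exists `|B| => y yB; have y0 : 0 <= y by apply: ltW; apply: le_lt_trans yB.
have [a [ia ba]] := vec_of_poly_system (hB _ (lt_expR_abs yB)).
rewrite sum3_eval2 expR_powR => /andP[a0 a1]; exists a; split=> //.
rewrite a0 /=; apply: le_trans a1 _; rewrite ler_expR; nra.
Qed.

End Exponents.

Theorem theorem2p1 (R : realType) (zeta : R) (hzeta : extremal zeta) :
  [/\ w 3 zeta = w 2 zeta,
      w 2 zeta = (2 + Num.sqrt 5)%:E,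
      lambda 3 zeta = (1 / Num.sqrt 5)%:E,
      w_hat 3 zeta = 3%:E
    & lambda_hat 3 zeta = (1 / 3)%:E].
Proof.
have [htr hw] := hzeta.
have hroy : forall eps T, 0 < eps <= 1 / 20 -> exists Q t, roy_seq zeta eps T Q t.
  apply: roy_seq_exists; first exact: transcendental_nonzero3.
  move=> eta he; apply: uniform2_of_w_hat hw _.
  by rewrite sqrt5_golden; lra.
have d20 (d : R) : 0 < d <= 1 / 20 -> 0 < d <= 1.
  by move=> /andP[-> h] /=; lra.
(* Both exponents are squeezed at once: the lower bound is proved in degree 2, the upper bound in
   degree 3, and solutions of degree 2 count in degree 3. *)
have w2_low (delta B : R) : 0 < delta <= 1 / 20 -> exists2 y, B < y &
    poly_system 2 zeta (2 + Num.sqrt 5 - delta) (expR y).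
  move=> hd; have [Q [t rs]] := hroy delta (B + 1) hd.
  exists (t 0%N); first by have := rs_start rs 0; lra.
  apply: (poly_system_of_vec (rs_int rs 0) (rs_bounded rs 0)).
  rewrite sum3_eval2 expR_powR; have /andP[h1 h2] := rs_eval rs 0.
  rewrite (lt_le_trans (expR_gt0 _) h1) (le_trans h2) // ler_expR sqrt5_golden.
  by lra.
have w3_up (delta : R) : 0 < delta <= 1 / 20 -> exists B, forall y, B < y ->
    ~ poly_system 3 zeta (2 + Num.sqrt 5 + delta) (expR y).
  move=> /d20 hd; have [B hB] := w3_upper hroy hd; exists B => y yB.
  move=> /cubic_solutionP; have -> : 2 + Num.sqrt 5 + delta = 2 * golden + 1 + delta.
    by rewrite sqrt5_golden; ring.
  exact: hB.
have w2E : w 2 zeta = (2 + Num.sqrt 5)%:E.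
  apply: ereal_sup_arbitrary => //; first exact: poly_system_mono.
  move=> delta hd; have [B hB] := w3_up delta hd; exists B => y yB.
  by move=> /(poly_system_degree (isT : (2 <= 3)%N)); apply: hB.
have w3E : w 3 zeta = (2 + Num.sqrt 5)%:E.
  apply: ereal_sup_arbitrary => //; first exact: poly_system_mono.
  move=> delta B hd; have [y yB h] := w2_low delta B hd; exists y => //.
  exact: poly_system_degree h.
have hr : 1 / Num.sqrt 5 * (2 * golden - 1) = 1 :> R.
  by rewrite -sqrt5_golden divfK // gt_eqF // sqrtr_gt0.
split=> //; first by rewrite w3E w2E.
- apply: ereal_sup_arbitrary; first exact: simul_system_mono.
    move=> delta B hd; have [y yB h] := lambda3_lower hr hroy B hd.
    by exists y => //; apply/simul_solutionP.
  move=> delta hd; have [B hB] := lambda3_upper hr hroy hd.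
  by exists B => y yB /simul_solutionP; apply: hB.
- apply: ereal_sup_sufficient; first exact: poly_system_mono.
    move=> delta /andP[d0 _].
    have htr4 p : int_vec p -> (exists2 j, (j < 4)%N & p j != 0) ->
        pair4 p (powers zeta) != 0.
      by move=> ip hp; rewrite -sum4_pair4; apply: transcendental_sum.
    have [B hB] := w_hat3_lower htr4 d0.
    by exists B => y yB; apply/cubic_solutionP/hB.
  move=> delta B /d20 hd; have [y yB h] := w_hat3_upper hroy B hd.
  by exists y => // /cubic_solutionP.
apply: ereal_sup_sufficient; first exact: simul_system_mono.
  move=> delta /andP[d0 _]; have [B hB] := lambda_hat3_lower zeta d0.
  by exists B => y yB; apply/simul_solutionP/hB.
move=> delta B /d20 hd; have [y yB h] := lambda_hat3_upper hroy B hd.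
by exists y => // /simul_solutionP.
Qed.
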